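(* Assume $\mu>0$ and $B\ne0$. Let $J(K^* )\le\beta<\alpha$, and let $\omega$ denote the distance between $\mathbb{K}_\beta$ and $(\mathbb{K}_\alpha^o)^c$. Let $L$ and $M$ be the constants (depending on $\alpha$) given in the context. Let $K^\ddag\in\mathbb{K}_\beta$ be a local minimum of $J$ with positive definite Hessian, i.e. $l:=\lambda_{\min}(\nabla^2J(\mathrm{vec}(K^\ddag)))>0$. Define $\bar r:=2l/M$ and $r_0:=\|K_0-K^\ddag\|_F$. If $r_0<\bar r$ and $\bar r r_0/(\bar r-r_0)\le\omega$, then gradient descent $K_{i+1}=K_i-\eta\nabla J(K_i)$ started at $K_0$ with a fixed step size $0<\eta\le1/L$ satisfies, for all $i\ge0$, $$\|K_i-K^\ddag\|_F\le\frac{\bar r r_0}{\bar r-r_0}\Big(\frac{1}{1+\eta l}\Big)^i.$$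
   Context: Setting: $A\in\mathbb{R}^{n\times n}$, $B\in\mathbb{R}^{n\times m}$, $C\in\mathbb{R}^{d\times n}$ with $C$ of full row rank; $Q\in\mathbb{R}^{n\times n}$ and $R\in\mathbb{R}^{m\times m}$ are symmetric positive definite. The system is $x_{t+1}=Ax_t+Bu_t$, $y_t=Cx_t$, with static output feedback $u_t=-Ky_t$, $K\in\mathbb{R}^{m\times d}$, so that $x_{t+1}=(A-BKC)x_t$. The initial state $x_0$ is drawn from a distribution $\mathcal{D}$ with second-moment matrix $X_0:=\mathbb{E}_{x_0\sim\mathcal{D}}[x_0x_0^\top]\in\mathbb{R}^{n\times n}$, and $\mu:=\sigma_{\min}(X_0)$ is the minimal singular value of $X_0$. The feasible set is $\mathbb{K}=\{K\in\mathbb{R}^{m\times d}:\rho(A-BKC)<1\}$ ($\rho$ = spectral radius), assumed nonempty. For $K\in\mathbb{K}$ the cost is $J(K)=\mathbb{E}_{x_0\sim\mathcal{D}}\big[\sum_{t=0}^\infty x_t^\top(Q+C^\top K^\top RKC)x_t\big]$. Equivalently $J(K)=\mathrm{Tr}(P_KX_0)$, where $P_K$ is the solution of $P_K=Q+C^\top K^\top RKC+(A-BKC)^\top P_K(A-BKC)$. $K^*$ is a global minimizer of $J$ over $\mathbb{K}$. $\|\cdot\|$ is the spectral norm, $\|\cdot\|_F$ the Frobenius norm, $\sigma_{\min}$ the minimal singular value, $\lambda_{\min}$ the minimal eigenvalue. $\nabla J(K)\in\mathbb{R}^{m\times d}$ is the gradient with respect to the Frobenius inner product, and $\nabla^2J(\mathrm{vec}(K))\in\mathbb{R}^{md\times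 md}$ is the Hessian of $J$ regarded as a function of the vectorization $\mathrm{vec}(K)$. Sets: $\mathbb{K}_\alpha=\{K\in\mathbb{K}:J(K)\le\alpha\}$ (similarly $\mathbb{K}_\beta$), $\mathbb{K}_\alpha^o=\{K\in\mathbb{K}:J(K)<\alpha\}$, and $(\mathbb{K}_\alpha^o)^c$ is its complement in $\mathbb{R}^{m\times d}$. The distance between $\mathbb{K}_\beta$ and $(\mathbb{K}_\alpha^o)^c$ is $\inf\{\|x-y\|: x\in\mathbb{K}_\beta,\ y\in(\mathbb{K}_\alpha^o)^c\}$. Constants: $\gamma:=\max_{K\in\mathbb{K}_\alpha}\|A-BKC\|$, $$q_3:=\frac{\sqrt{\|R\|\alpha+\|B\|^2\alpha^2/\mu}}{\sqrt{\mu}\,\sigma_{\min}(R)}+\frac{\|B\|\|A\|\alpha}{\mu\,\sigma_{\min}(R)},$$ $$\zeta_1 = \frac{1}{\sigma_{\min}(Q)}\Big((1+\|C\|^2\|B\|^2)\frac{\alpha}{\mu}+\|C\|^2\|R\|\Big)-1,$$ $$\zeta_2=\frac{2}{\sigma_{\min}(Q)}\Big(\|C\|\|R\|q_3+\gamma\|C\|\|B\|\frac{\alpha}{\mu}\Big),$$ $$\zeta_3=\frac{2}{\sigma_{\min}(Q)}\Big(\|C\|^2\|R\|+\|C\|\|B\|\big(\|C\|\|B\|+\zeta_1\gamma+\zeta_2\gamma\big)\frac{\alpha}{\mu}\Big),$$ $$\zeta_4=\frac{2}{\sigma_{\min}(Q)}\Big(\|C\|^2\|R\|+\|C\|\|B\|\big(\|C\|\|B\|+\zeta_1\gamma\big)\frac{\alpha}{\mu}\Big),$$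 $$L=2\|C\|^2\Big(\|R\|+\|B\|^2\Big(1+\frac{2\zeta_1}{\|C\|\|B\|}\Big)\frac{\alpha}{\mu}\Big)\frac{\alpha}{\sigma_{\min}(Q)},$$ $$M=\frac{2\alpha^2}{\mu\,\sigma_{\min}(Q)}\|B\|\|C\|\big((2\zeta_1+\zeta_2)\|B\|\|C\|+2\zeta_3+\zeta_4\big).$$ *)

(* Defs.v *)
From HB Require Import structures.
From mathcomp Require Import all_boot all_order all_algebra.
From mathcomp Require Import complex.
From mathcomp Require Import all_classical all_reals all_analysis.

Set Implicit Arguments.
Unset Strict Implicit.
Unset Printing Implicit Defensive.

Import Order.TTheory GRing.Theory Num.Theory.
Import numFieldNormedType.Exports.

Local Open Scope classical_set_scope.
Local Open Scope ring_scope.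

Section matrices.
Variable R : realType.

Definition posdefmx n (X : 'M[R]_n) : Prop :=
  X^T = X /\ forall x : 'cV[R]_n, x != 0 -> 0 < (x^T *m X *m x) ord0 ord0.

Definition frobenius_norm m n (X : 'M[R]_(m, n)) : R :=
  Num.sqrt (\sum_i \sum_j X i j ^+ 2).

(* For m < n this set also contains 0 even when X has full rank; only its
   maximum is used for rectangular matrices. *)
Definition singular_values m n (X : 'M[R]_(m, n)) : set R :=
  [set Num.sqrt a | a in [set a | eigenvalue (X^T *m X) a]].

(* The sets below are finite, so the sup and inf are a maximum and a minimum
   whenever they are nonempty. *)
Definition spectral_norm m n (X : 'M[R]_(m, n)) : R := sup (singular_values X).

Definition sigma_min n (X : 'M[R]_n) : R := inf (singular_values X).

(* Meant for symmetric X, all of whose eigenvalues are real. *)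
Definition lambda_min n (X : 'M[R]_n) : R := inf [set a | eigenvalue X a].

Definition spectral_radius n (X : 'M[R]_n) : R :=
  sup [set ComplexField.Normc.normc z |
       z in [set z | eigenvalue (map_mx (real_complex R) X) z]].

(* The matrix G with 'd f K E = <G, E>_F for all E, whenever f is
   differentiable at K. *)
Definition gradient m n (f : 'M[R]_(m, n) -> R) (K : 'M[R]_(m, n)) :
    'M[R]_(m, n) :=
  \matrix_(i, j) 'd f K (delta_mx i j).

Definition hessian n (f : 'rV[R]_n -> R) (v : 'rV[R]_n) : 'M[R]_n :=
  'J (gradient f) v.

(* The Hessian of f as a function of vec(K). The vectorization is mxvec, which
   is row-major; column-major stacking would permute the basis of
   R^(m * n) and hence leave the eigenvalues unchanged. *)
Definition vec_hessian m n (f : 'M[R]_(m, n) -> R) (K : 'M[R]_(m, n)) :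
    'M[R]_(m * n) :=
  hessian (fun v => f (vec_mx v)) (mxvec K).

Definition local_min_in m n (D : set 'M[R]_(m, n)) (f : 'M[R]_(m, n) -> R)
    (K : 'M[R]_(m, n)) : Prop :=
  \forall K' \near K, D K' -> f K <= f K'.

Definition global_min_in m n (D : set 'M[R]_(m, n)) (f : 'M[R]_(m, n) -> R)
    (K : 'M[R]_(m, n)) : Prop :=
  D K /\ forall K', D K' -> f K <= f K'.

Definition gradient_descent m n (f : 'M[R]_(m, n) -> R) (eta : R)
    (K0 : 'M[R]_(m, n)) (i : nat) : 'M[R]_(m, n) :=
  iter i (fun K => K - eta *: gradient f K) K0.

End matrices.

(* The distribution of the initial state is the law of the random vector
   (x_init i)_i under P. *)
Record sof_lqr (R : realType) (disp : measure_display)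
    (Omega : measurableType disp) (P : probability Omega R) (n m d : nat) :=
  SofLqr {
    Amx : 'M[R]_n;
    Bmx : 'M[R]_(n, m);
    Cmx : 'M[R]_(d, n);
    Qmx : 'M[R]_n;
    Rmx : 'M[R]_m;
    x_init : 'I_n -> {RV P >-> R}
  }.

Section output_feedback.
Context (R : realType) (disp : measure_display) (Omega : measurableType disp).
Context (P : probability Omega R) (n m d : nat) (S : sof_lqr P n m d).

Local Notation A := (Amx S).
Local Notation B := (Bmx S).
Local Notation C := (Cmx S).
Local Notation Q := (Qmx S).
Local Notation Rm := (Rmx S).
Local Notation "`‖ X ‖" := (spectral_norm X) (at level 0).

Definition second_moment : 'M[R]_n :=
  \matrix_(i, j) fine ('E_P[x_init S i \* x_init S j])%E.

Definition mu : R := sigma_min second_moment.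

Definition closed_loop (K : 'M[R]_(m, d)) : 'M[R]_n := A - B *m K *m C.

Definition stabilizing : set 'M[R]_(m, d) :=
  [set K | spectral_radius (closed_loop K) < 1].

Definition state (K : 'M[R]_(m, d)) (w : Omega) (t : nat) : 'cV[R]_n :=
  iter t (fun x => closed_loop K *m x) (\col_i x_init S i w).

Definition stage_cost (K : 'M[R]_(m, d)) (x : 'cV[R]_n) : R :=
  (x^T *m (Q + C^T *m K^T *m Rm *m K *m C) *m x) ord0 ord0.

(* The expectation is an extended real; it is finite for stabilizing K when the
   initial state is square integrable. Outside of stabilizing the value of cost
   carries no meaning. *)
Definition cost (K : 'M[R]_(m, d)) : R :=
  fine (\int[P]_w \sum_(0 <= t <oo) (stage_cost K (state K w t))%:E)%E.

Definition sublevel (a : R) : set 'M[R]_(m, d) :=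
  [set K | stabilizing K /\ cost K <= a].

Definition strict_sublevel (a : R) : set 'M[R]_(m, d) :=
  [set K | stabilizing K /\ cost K < a].

(* The distance between the two sets in spectral, not Frobenius, norm. *)
Definition sublevel_dist (b a : R) : \bar R :=
  ereal_inf [set (`‖X - Y‖)%:E |
             X in sublevel b & Y in ~` strict_sublevel a].

(* A maximum: sublevel a is compact when Q and R are positive definite, C has
   full row rank and mu > 0. *)
Definition gamma (a : R) : R :=
  sup [set `‖closed_loop K‖ | K in sublevel a].

Definition q3 (a : R) : R :=
  Num.sqrt (`‖Rm‖ * a + `‖B‖ ^+ 2 * a ^+ 2 / mu)
    / (Num.sqrt mu * sigma_min Rm)
  + `‖B‖ * `‖A‖ * a / (mu * sigma_min Rm).

Definition zeta1 (a : R) : R :=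
  (sigma_min Q)^-1
    * ((1 + `‖C‖ ^+ 2 * `‖B‖ ^+ 2) * (a / mu) + `‖C‖ ^+ 2 * `‖Rm‖) - 1.

Definition zeta2 (a : R) : R :=
  2 / sigma_min Q
    * (`‖C‖ * `‖Rm‖ * q3 a + gamma a * `‖C‖ * `‖B‖ * (a / mu)).

Definition zeta3 (a : R) : R :=
  2 / sigma_min Q
    * (`‖C‖ ^+ 2 * `‖Rm‖
       + `‖C‖ * `‖B‖
         * (`‖C‖ * `‖B‖ + zeta1 a * gamma a + zeta2 a * gamma a) * (a / mu)).

Definition zeta4 (a : R) : R :=
  2 / sigma_min Q
    * (`‖C‖ ^+ 2 * `‖Rm‖
       + `‖C‖ * `‖B‖ * (`‖C‖ * `‖B‖ + zeta1 a * gamma a) * (a / mu)).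

(* smoothness_const (usually written L) and hessian_lipschitz_const (M) are
   explicit bounds for the Lipschitz constants of the gradient and of the
   Hessian of cost on sublevel a. *)
Definition smoothness_const (a : R) : R :=
  2 * `‖C‖ ^+ 2
    * (`‖Rm‖ + `‖B‖ ^+ 2 * (1 + 2 * zeta1 a / (`‖C‖ * `‖B‖)) * (a / mu))
    * (a / sigma_min Q).

Definition hessian_lipschitz_const (a : R) : R :=
  2 * a ^+ 2 / (mu * sigma_min Q) * `‖B‖ * `‖C‖
    * ((2 * zeta1 a + zeta2 a) * `‖B‖ * `‖C‖ + 2 * zeta3 a + zeta4 a).

End output_feedback.

(* Main.v *)
Require Import Defs.
From mathcomp Require Import all_boot all_order all_algebra.
From mathcomp Require Import complex.
From mathcomp Require Import ring lra.
From mathcomp Require Import all_classical all_reals all_analysis.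
From mathcomp Require Import measurable_realfun.
Set Implicit Arguments.
Unset Strict Implicit.
Unset Printing Implicit Defensive.
Import Order.TTheory GRing.Theory Num.Theory.
Import numFieldNormedType.Exports.
Local Open Scope classical_set_scope.
Local Open Scope ring_scope.

(** Write A_K = A - B K C and let P_K solve the Stein equation
    P = A_K^T P A_K + Q + C^T K^T R K C. On the open set of stabilizing gains the
    cost is tr(P_K X0) (costE), a rational function of K. Differentiating the
    Stein equation shows that every directional derivative of P_K solves a Stein
    equation with the same A_K and an explicit source (mxder_lyap, src1, src2,
    src3), so the derivatives of the cost are tr(N Sigma) for explicit symmetric
    N, with Sigma >= X0 the accumulated second moment of the states.

    The local analysis is classical. Let E = K_i - K' be the error at the local
    minimum K', where the gradient vanishes, and H(t) the Hessian at K' + t E. The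
    new error is the integral of (I - eta H(t)) E over [0, 1]. On the sublevel set
    of alpha the Hessian is at most L and changes by at most M per unit of
    Frobenius length, so 0 <= I - eta H(t) <= 1 - eta l + eta M t |E| and
    |E_new| <= (1 - eta l + eta M |E| / 2) |E| (descent_step). With rbar = 2 l / M
    this recursion gives |E_i| <= rbar r0 / (r0 + (1 + eta l)^i (rbar - r0))
    (nesterov_step, descent_rate). The errors never exceed r0, and
    r0 < rbar r0 / (rbar - r0) <= omega unless r0 = 0, so all segments stay in the
    sublevel set of alpha (near_sublevel_sub).

    The quantitative part is that the explicit L and M are valid
    (second_derivative_le, third_derivative_le). All bounds are comparisons of
    quadratic forms. As Q >= s I with s = sigma_min Q, a source between - a s I and
    a s I gives a solution between - a P_K and a P_K (lyap_le_value_matrix), while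
    P_K <= alpha / mu (value_matrix_le) and s tr(Sigma) <= alpha. For a unit
    direction the source of the first derivative is at most zeta1 s, by completing
    squares (src1_zeta1); products through A_K are controlled by
    A_K^T P_K A_K <= P_K, which is sharper than the norm of A_K when that exceeds
    1. Comparing the resulting bound on the third derivative with M is delicate,
    because zeta4 contains the product of zeta1 and gamma once where the estimate
    produces it twice. A second bound on the source, in terms of the part of the
    cost spent on controls (src1_control), lies below zeta2 (zeta2_ge), and the
    same part is missing from s tr(Sigma) (state_trace1_le); together they make up
    the deficit (core_constant_ineq). *)

(** * Quadratic forms and the trace inner product *)

Section real_inequalities.
Variable R : realType.
Implicit Types a b c t : R.

Lemma discriminant_le a b c :
  (forall t, 0 <= a + 2 * b * t + c * t ^+ 2) -> 0 <= c -> b ^+ 2 <= a * c.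
Proof.
(* The polynomial takes the value (ac - b^2) / c at t = -b / c; if c = 0 and
   b != 0 it is -1 at t = - (a + 1) / (2b). *)
move=> h c0; have [c0'|cn0] := eqVneq c 0.
  rewrite c0' mulr0; have [->|bn0] := eqVneq b 0; first by rewrite expr0n.
  have := h (- (a + 1) / (2 * b)); rewrite c0' mul0r addr0 => h1.
  have e : 2 * b * (- (a + 1) / (2 * b)) = - (a + 1) by field.
  by move: h1; rewrite e; lra.
have cp : 0 < c by rewrite lt_def cn0.
have := h (- b / c); have -> : a + 2 * b * (- b / c) + c * (- b / c) ^+ 2 =
  (a * c - b ^+ 2) / c by field.
by rewrite pmulr_lge0 ?invr_gt0// subr_ge0.
Qed.

Lemma bilinear_bound (b a c : R) : b ^+ 2 <= a ^+ 2 * c ^+ 2 -> 0 <= a -> 0 <= c ->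
  `|b| <= a * c.
Proof.
move=> h a0 c0; rewrite -[a * c]ger0_norm ?mulr_ge0// -ler_sqr ?nnegrE//.
by rewrite -!normrX ger0_norm ?sqr_ge0// ger0_norm ?sqr_ge0// exprMn.
Qed.

End real_inequalities.

Section trace_inner_product.
Variable R : realType.

(** The Frobenius inner product. For a column x the form x^T X x is
    dot x (X *m x), and adjoints move across by transposition. *)
Definition dot m n (X Y : 'M[R]_(m, n)) : R := \tr (X^T *m Y).

Section fixed_size.
Variables m n : nat.
Implicit Types X Y Z : 'M[R]_(m, n).

Lemma dotE X Y : dot X Y = \sum_i \sum_j X i j * Y i j.
Proof.
rewrite /dot /mxtrace exchange_big /=; apply: eq_bigr => j _.
by rewrite mxE; apply: eq_bigr => i _; rewrite mxE.
Qed.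

Lemma dotC X Y : dot X Y = dot Y X.
Proof. by rewrite /dot -mxtrace_tr trmx_mul trmxK. Qed.

Lemma dotDl X Y Z : dot (X + Y) Z = dot X Z + dot Y Z.
Proof. by rewrite /dot linearD/= mulmxDl mxtraceD. Qed.
Lemma dotDr X Y Z : dot Z (X + Y) = dot Z X + dot Z Y.
Proof. by rewrite dotC dotDl !(dotC Z). Qed.
Lemma dotZl a X Y : dot (a *: X) Y = a * dot X Y.
Proof. by rewrite /dot linearZ/= -scalemxAl mxtraceZ. Qed.
Lemma dotZr a X Y : dot X (a *: Y) = a * dot X Y.
Proof. by rewrite dotC dotZl dotC. Qed.
Lemma dotNl X Y : dot (- X) Y = - dot X Y.
Proof. by rewrite -scaleN1r dotZl mulN1r. Qed.
Lemma dotNr X Y : dot X (- Y) = - dot X Y.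
Proof. by rewrite -scaleN1r dotZr mulN1r. Qed.
Lemma dotBl X Y Z : dot (X - Y) Z = dot X Z - dot Y Z.
Proof. by rewrite dotDl dotNl. Qed.
Lemma dotBr X Y Z : dot Z (X - Y) = dot Z X - dot Z Y.
Proof. by rewrite dotDr dotNr. Qed.
Lemma dot0l X : dot 0 X = 0.
Proof. by rewrite -(scale0r 0) dotZl mul0r. Qed.
Lemma dot0r X : dot X 0 = 0.
Proof. by rewrite dotC dot0l. Qed.

Lemma dot_ge0 X : 0 <= dot X X.
Proof. by rewrite dotE; do 2!apply: sumr_ge0 => ? _; rewrite -expr2 sqr_ge0. Qed.

Lemma dot_eq0 X : (dot X X == 0) = (X == 0).
Proof.
apply/eqP/eqP => [|->]; last exact: dot0l.
rewrite dotE => h; apply/matrixP => i j; rewrite mxE.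
have sq k l : 0 <= X k l * X k l by rewrite -expr2 sqr_ge0.
have h1 : \sum_j X i j * X i j = 0.
  move/eqP: h; rewrite psumr_eq0 => [/allP/(_ i)|k _]; last exact: sumr_ge0.
  by rewrite mem_index_enum => /(_ isT)/eqP.
move/eqP: h1; rewrite psumr_eq0 => [/allP/(_ j)|k _//].
by rewrite mem_index_enum -expr2 sqrf_eq0 => /(_ isT)/eqP.
Qed.

Lemma dot_gt0 X : X != 0 -> 0 < dot X X.
Proof. by move=> X0; rewrite lt_def dot_eq0 X0 dot_ge0. Qed.

Lemma frobenius_normE X : frobenius_norm X = Num.sqrt (dot X X).
Proof. by rewrite /frobenius_norm dotE. Qed.

Lemma frobenius_norm_ge0 X : 0 <= frobenius_norm X.
Proof. exact: sqrtr_ge0. Qed.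

Lemma sqr_frobenius_norm X : frobenius_norm X ^+ 2 = dot X X.
Proof. by rewrite frobenius_normE sqr_sqrtr ?dot_ge0. Qed.

Lemma frobenius_normZ a X : frobenius_norm (a *: X) = `|a| * frobenius_norm X.
Proof.
rewrite !frobenius_normE dotZl dotZr mulrA -expr2 sqrtrM ?sqr_ge0//.
by rewrite sqrtr_sqr.
Qed.

Lemma frobenius_norm_eq0 X : (frobenius_norm X == 0) = (X == 0).
Proof. by rewrite -sqrf_eq0 sqr_frobenius_norm dot_eq0. Qed.

End fixed_size.

Lemma dot_adjoint m n k (A : 'M[R]_(m, n)) (X : 'M[R]_(n, k)) (Y : 'M[R]_(m, k)) :
  dot (A *m X) Y = dot X (A^T *m Y).
Proof. by rewrite /dot trmx_mul mulmxA. Qed.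

(** Polarization: 4 t x^T S y is the difference of the values of the form S at
    x + t y and x - t y, hence at least - 2 z (W(x) + t^2 W(y)). The discriminant
    of this quadratic in t gives a Cauchy-Schwarz inequality in which S need not
    be semidefinite. *)
Lemma dominated_schwarz n k (S W : 'M[R]_n) (z : R) : S^T = S -> W^T = W ->
  0 <= z ->
  (forall x : 'M[R]_(n, k), `|dot x (S *m x)| <= z * dot x (W *m x)) ->
  forall x y : 'M[R]_(n, k),
    (dot x (S *m y)) ^+ 2 <= z ^+ 2 * (dot x (W *m x) * dot y (W *m y)).
Proof.
move=> sS sW z0 h x y.
have symm (T : 'M[R]_n) (u v : 'M[R]_(n, k)) : T^T = T -> dot u (T *m v) = dot v (T *m u).
  by move=> sT; rewrite dotC dot_adjoint sT.
have -> : z ^+ 2 * (dot x (W *m x) * dot y (W *m y)) =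
  (z * dot x (W *m x)) * (z * dot y (W *m y)) by ring.
apply: discriminant_le => [t|]; last exact: (le_trans (normr_ge0 _) (h y)).
have hp := h (x + t *: y); have hm := h (x - t *: y).
have E (T : 'M[R]_n) (u : R) : T^T = T -> dot (x + u *: y) (T *m (x + u *: y)) =
   dot x (T *m x) + 2 * u * dot x (T *m y) + u ^+ 2 * dot y (T *m y).
  move=> sT; rewrite mulmxDr -scalemxAr !dotDl !dotDr !dotZl !dotZr.
  by rewrite (symm T y x sT); ring.
rewrite !E// in hp; rewrite -scaleNr !E// in hm.
move: hp hm; rewrite !ler_norml => /andP[h1 h2] /andP[h3 h4].
nra.
Qed.

Lemma dot_schwarz m n (x y : 'M[R]_(m, n)) : (dot x y) ^+ 2 <= dot x x * dot y y.
Proof.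
have := @dominated_schwarz m n 1%:M 1%:M 1 (trmx1 _ _) (trmx1 _ _) ler01.
move=> /(_ _ x y); rewrite !mul1mx expr1n mul1r; apply => z.
by rewrite !mul1mx mul1r ger0_norm ?dot_ge0.
Qed.

Lemma dot_frobenius m n (x y : 'M[R]_(m, n)) :
  `|dot x y| <= frobenius_norm x * frobenius_norm y.
Proof.
apply: bilinear_bound; rewrite ?frobenius_norm_ge0//.
by rewrite !sqr_frobenius_norm dot_schwarz.
Qed.

End trace_inner_product.


(** * Spectral norm and minimal singular value *)

Section rayleigh_quotient.
Variable R : realType.

Lemma frobenius_normM m n k (X : 'M[R]_(m, n)) (Y : 'M[R]_(n, k)) :
  frobenius_norm (X *m Y) <= frobenius_norm X * frobenius_norm Y.
Proof.
rewrite -ler_sqr ?nnegrE ?mulr_ge0 ?frobenius_norm_ge0//.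
rewrite exprMn !sqr_frobenius_norm.
rewrite [dot (X *m Y) _]dotE [dot X X]dotE [dot Y Y]dotE mulr_suml.
apply: ler_sum => i _; rewrite exchange_big /= mulr_sumr; apply: ler_sum => j _.
have := dot_schwarz (row i X) (col j Y)^T.
rewrite !dotE !big_ord1 expr2 => h.
have -> : (X *m Y) i j = \sum_l row i X 0 l * (col j Y)^T 0 l.
  by rewrite mxE; apply: eq_bigr => l _; rewrite !mxE.
apply: le_trans h _; rewrite le_eqVlt; apply/orP; left; apply/eqP; congr (_ * _).
  by apply: eq_bigr => l _; rewrite !mxE.
by apply: eq_bigr => l _; rewrite !mxE.
Qed.

Lemma sqr_dot_mulmx_le m n k (X : 'M[R]_(m, n)) (Y : 'M[R]_(n, k)) :
  dot (X *m Y) (X *m Y) <= frobenius_norm X ^+ 2 * dot Y Y.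
Proof.
rewrite -!sqr_frobenius_norm -exprMn ler_sqr ?nnegrE ?mulr_ge0 ?frobenius_norm_ge0//.
exact: frobenius_normM.
Qed.

Lemma dot_mulmx_le n k (X : 'M[R]_n) (Y : 'M[R]_(n, k)) :
  `|dot Y (X *m Y)| <= frobenius_norm X * dot Y Y.
Proof.
apply: le_trans (dot_frobenius _ _) _.
rewrite -sqr_frobenius_norm expr2 mulrA [leRHS]mulrC ler_wpM2l ?frobenius_norm_ge0//.
by apply: le_trans (frobenius_normM _ _) _; rewrite mulrC.
Qed.

Lemma unit_vector n (x : 'cV[R]_n) : x != 0 ->
  dot ((frobenius_norm x)^-1 *: x) ((frobenius_norm x)^-1 *: x) = 1.
Proof.
move=> x0; rewrite dotZl dotZr mulrA -expr2 -sqr_frobenius_norm -exprMn mulVf ?expr1n//.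
by rewrite frobenius_norm_eq0.
Qed.

Lemma quadratic_form_homogeneous n (X : 'M[R]_n) (a : R) :
  (forall x : 'cV[R]_n, dot x x = 1 -> a <= dot x (X *m x)) ->
  forall x : 'cV[R]_n, a * dot x x <= dot x (X *m x).
Proof.
move=> h x; have [->|x0] := eqVneq x 0; first by rewrite !dot0l mulr0.
have := h _ (unit_vector x0); rewrite -scalemxAr dotZl dotZr mulrA -expr2 => H.
rewrite -sqr_frobenius_norm -ler_pdivlMr ?exprn_gt0//; last first.
  by rewrite lt_def frobenius_norm_eq0 x0 frobenius_norm_ge0.
by rewrite mulrC -exprVn.
Qed.

Lemma eigenvalue_symmetricP n (X : 'M[R]_n) a : X^T = X ->
  eigenvalue X a -> exists2 x : 'cV[R]_n, X *m x = a *: x & dot x x = 1.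
Proof.
move=> sX /eigenvalueP[v vX v0].
have v0' : v^T != 0 by rewrite -trmx0 (inj_eq (@trmx_inj _ _ _)).
exists ((frobenius_norm v^T)^-1 *: v^T); last exact: unit_vector.
by rewrite -scalemxAr -[X in X *m _]sX -trmx_mul vX linearZ/= scalerA mulrC -scalerA.
Qed.

Lemma exists_unit_vector n : (0 < n)%N -> exists x : 'cV[R]_n, dot x x = 1.
Proof.
case: n => // n _; exists ((frobenius_norm (const_mx 1 : 'cV[R]_n.+1))^-1 *: const_mx 1).
by apply: unit_vector; apply/eqP => /matrixP/(_ 0 0); rewrite !mxE => /eqP; rewrite oner_eq0.
Qed.

(** The infimum of the Rayleigh quotient is an eigenvalue: otherwise X - inf
    would be positive semidefinite and invertible, and Cauchy-Schwarz for its
    form bounds such a matrix away from zero. *)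
Lemma rayleigh_attained n (X : 'M[R]_n) : (0 < n)%N -> X^T = X ->
  exists2 a, eigenvalue X a & forall x : 'cV[R]_n, a * dot x x <= dot x (X *m x).
Proof.
move=> n0 sX; pose S := [set dot x (X *m x) | x in [set x : 'cV[R]_n | dot x x = 1]].
have lbS : lbound S (- frobenius_norm X).
  move=> _ [x /= x1 <-]; have := dot_mulmx_le X x.
  by rewrite x1 mulr1 ler_norml => /andP[].
have hiS : has_inf S.
  split; last by exists (- frobenius_norm X).
  by have [x x1] := exists_unit_vector n0; exists (dot x (X *m x)), x.
have h : forall x : 'cV[R]_n, inf S * dot x x <= dot x (X *m x).
  by apply: quadratic_form_homogeneous => x x1; apply: (ge_inf hiS.2); exists x.
exists (inf S) => //; apply: contrapT => /negP ne.
pose Y := X - (inf S)%:M.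
have uY : Y \in unitmx.
  rewrite -row_free_unit -kermx_eq0; move: ne.
  by rewrite /eigenvalue /eigenspace negbK.
have sY : Y^T = Y by rewrite /Y linearB/= sX tr_scalar_mx.
have YE (x : 'cV[R]_n) : dot x (Y *m x) = dot x (X *m x) - inf S * dot x x.
  by rewrite /Y mulmxBl dotBr mul_scalar_mx dotZr.
have Y0 (x : 'cV[R]_n) : 0 <= dot x (Y *m x) by rewrite YE subr_ge0.
pose f := frobenius_norm (invmx Y).
have gap (x : 'cV[R]_n) : dot x x = 1 -> 1 <= f * dot x (Y *m x).
  move=> x1; have := @dominated_schwarz _ _ 1 Y Y 1 sY sY ler01.
  move=> /(_ _ x (invmx Y *m x)); rewrite mulKVmx// x1 !expr1n mul1r => H.
  apply: le_trans (H _) _ => [z|]; first by rewrite mul1r ger0_norm.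
  rewrite [leRHS]mulrC ler_wpM2l// dotC.
  by have := dot_mulmx_le (invmx Y) x; rewrite x1 mulr1; apply: le_trans; rewrite ler_norm.
have f0 : 0 < f.
  have [x x1] := exists_unit_vector n0; have := gap _ x1.
  rewrite lt_def frobenius_norm_ge0 andbT; apply: contraTneq => ->.
  by rewrite mul0r -ltNge.
suff : inf S + f^-1 <= inf S by rewrite gerDl leNgt invr_gt0 f0.
apply: (lb_le_inf hiS.1) => _ [x /= x1 <-].
have := gap _ x1; rewrite -ler_pdivrMl// mulr1 YE x1; lra.
Qed.

Lemma lambda_min_rayleigh n (X : 'M[R]_n) (x : 'cV[R]_n) : X^T = X ->
  lambda_min X * dot x x <= dot x (X *m x).
Proof.
move=> sX; case: n X sX x => [|n] X sX x; first by rewrite (flatmx0 x) !dot0l mulr0.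
have [a ea ha] := rayleigh_attained (ltn0Sn n) sX.
apply: le_trans (ha x); rewrite ler_wpM2r ?dot_ge0//; apply: ge_inf => //.
exists a => b /(eigenvalue_symmetricP sX)[y yb y1].
by have := ha y; rewrite yb dotZr y1 !mulr1.
Qed.

Lemma trmx_gram m n (X : 'M[R]_(m, n)) : (X^T *m X)^T = X^T *m X.
Proof. by rewrite trmx_mul trmxK. Qed.

Lemma dot_gram m n k (X : 'M[R]_(m, n)) (x : 'M[R]_(n, k)) :
  dot x (X^T *m X *m x) = dot (X *m x) (X *m x).
Proof. by rewrite dot_adjoint mulmxA. Qed.

(** The largest eigenvalue of X^T X is the opposite of the least eigenvalue of
    - X^T X, which is attained; the spectral norm is its square root. *)
Lemma spectral_normP m n (X : 'M[R]_(m, n)) : 0 <= spectral_norm X /\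
  forall x : 'cV[R]_n, dot (X *m x) (X *m x) <= spectral_norm X ^+ 2 * dot x x.
Proof.
case: n X => [|n] X.
  rewrite /spectral_norm; have -> : singular_values X = set0.
    rewrite -subset0 => _ [a /= /eigenvalueP[v _] /negP[]].
    by rewrite (thinmx0 v).
  rewrite sup0; split=> // x.
  by rewrite (flatmx0 x) mulmx0 !dot0l mulr0.
have sN : (- (X^T *m X))^T = - (X^T *m X) by rewrite linearN/= trmx_gram.
have [a ea ha] := rayleigh_attained (ltn0Sn n) sN.
have ub (x : 'cV[R]_n.+1) : dot (X *m x) (X *m x) <= - a * dot x x.
  by have := ha x; rewrite mulNmx dotNr dot_gram; lra.
have eg : eigenvalue (X^T *m X) (- a).
  move/eigenvalueP: ea => [v vX v0]; apply/eigenvalueP; exists v => //.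
  by rewrite scaleNr -vX mulmxN opprK.
have ubS : has_sup (singular_values X).
  split; first by exists (Num.sqrt (- a)), (- a).
  exists (Num.sqrt (- a)) => _ [b /= /(eigenvalue_symmetricP (trmx_gram X))[y yb y1] <-].
  rewrite ler_wsqrtr//; have := ub y.
  by rewrite -dot_gram yb dotZr y1 !mulr1.
have sl : Num.sqrt (- a) <= spectral_norm X by apply: (ub_le_sup ubS.2); exists (- a).
have s0 := le_trans (sqrtr_ge0 _) sl; split=> // x.
apply: le_trans (ub x) _; rewrite ler_wpM2r ?dot_ge0//.
have [a0|/ltW a0] := leP 0 (- a); last by apply: le_trans a0 _; rewrite sqr_ge0.
by rewrite -[leLHS]sqr_sqrtr// ler_sqr ?nnegrE ?sqrtr_ge0.
Qed.

Lemma spectral_norm_ge0 m n (X : 'M[R]_(m, n)) : 0 <= spectral_norm X.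
Proof. by have [] := spectral_normP X. Qed.

Lemma spectral_norm_dot m n (X : 'M[R]_(m, n)) (x : 'cV[R]_n) :
  dot (X *m x) (X *m x) <= spectral_norm X ^+ 2 * dot x x.
Proof. by have [_] := spectral_normP X. Qed.

Lemma spectral_norm_le m n (X : 'M[R]_(m, n)) (c : R) : 0 <= c ->
  (forall x : 'cV[R]_n, dot (X *m x) (X *m x) <= c ^+ 2 * dot x x) -> spectral_norm X <= c.
Proof.
move=> c0 h; have [[b Sb]|] := pselect (singular_values X !=set0); last first.
  move=> /set0P/negP; rewrite negbK => /eqP S0.
  by rewrite /spectral_norm S0 sup0.
apply: ge_sup; first by exists b.
move=> _ [a /= /(eigenvalue_symmetricP (trmx_gram X))[y yb y1] <-].
have := h y; rewrite -dot_gram yb dotZr y1 !mulr1 => ac.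
by rewrite -(ger0_norm c0) -sqrtr_sqr ler_wsqrtr.
Qed.

Lemma spectral_norm_le_frobenius m n (X : 'M[R]_(m, n)) :
  spectral_norm X <= frobenius_norm X.
Proof.
by apply: spectral_norm_le (frobenius_norm_ge0 _) _ => x; exact: sqr_dot_mulmx_le.
Qed.

Lemma spectral_norm_gt0 m n (X : 'M[R]_(m, n)) : X != 0 -> 0 < spectral_norm X.
Proof.
move=> X0; rewrite lt_def spectral_norm_ge0 andbT; apply: contra X0 => /eqP s0.
apply/eqP/matrixP => i j; have := spectral_norm_dot X (delta_mx j 0).
rewrite s0 expr0n mul0r -colE => h; have /eqP : dot (col j X) (col j X) = 0.
  by apply/eqP; rewrite eq_le h dot_ge0.
by rewrite dot_eq0 => /eqP/matrixP/(_ i 0); rewrite !mxE.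
Qed.

Lemma dot_spectral_norm n (X : 'M[R]_n) (x y : 'cV[R]_n) :
  `|dot y (X *m x)| <= spectral_norm X * (frobenius_norm x * frobenius_norm y).
Proof.
apply: le_trans (dot_frobenius _ _) _.
rewrite mulrA mulrC ler_wpM2r ?frobenius_norm_ge0//.
rewrite -ler_sqr ?nnegrE ?mulr_ge0 ?frobenius_norm_ge0 ?spectral_norm_ge0//.
by rewrite exprMn !sqr_frobenius_norm spectral_norm_dot.
Qed.

Lemma dot_spectral_norm1 n (X : 'M[R]_n) (x : 'cV[R]_n) :
  dot x (X *m x) <= spectral_norm X * dot x x.
Proof.
apply: le_trans (ler_norm _) _; apply: le_trans (dot_spectral_norm _ _ _) _.
by rewrite -expr2 sqr_frobenius_norm.
Qed.

(** An eigenvalue a >= 0 of a symmetric X gives the eigenvalue a^2 of X^T X, so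
    the least eigenvalue of X is one of its singular values. *)
Lemma sigma_min_psd n (X : 'M[R]_n) : X^T = X ->
  (forall x : 'cV[R]_n, 0 <= dot x (X *m x)) ->
  forall x : 'cV[R]_n, sigma_min X * dot x x <= dot x (X *m x).
Proof.
move=> sX X0 x; case: n X sX X0 x => [|n] X sX X0 x.
  by rewrite (flatmx0 x) !dot0l mulr0.
have [a ea ha] := rayleigh_attained (ltn0Sn n) sX.
have [y ya y1] := eigenvalue_symmetricP sX ea.
have a0 : 0 <= a by have := X0 y; rewrite ya dotZr y1 mulr1.
apply: le_trans (ha x); rewrite ler_wpM2r ?dot_ge0//; apply: ge_inf.
  by exists 0 => _ [b _ <-]; exact: sqrtr_ge0.
exists (a ^+ 2); last by rewrite sqrtr_sqr ger0_norm.
move/eigenvalueP: ea => [v vX v0]; apply/eigenvalueP; exists v => //.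
by rewrite sX mulmxA vX -scalemxAl vX scalerA.
Qed.

(** Cauchy-Schwarz gives |X x| >= x^T X x for unit x, so no singular value is
    smaller than the least eigenvalue. *)
Lemma sigma_min_gt0 n (X : 'M[R]_n) : (0 < n)%N -> posdefmx X -> 0 < sigma_min X.
Proof.
move=> n0 [sX X0]; have [a ea ha] := rayleigh_attained n0 sX.
have [y ya y1] := eigenvalue_symmetricP sX ea.
have a0 : 0 < a.
  have y0 : y != 0 by rewrite -dot_eq0 y1 oner_eq0.
  have := X0 y y0; have -> : (y^T *m X *m y) ord0 ord0 = dot y (X *m y).
    by rewrite /dot mulmxA /mxtrace big_ord1.
  by rewrite ya dotZr y1 mulr1.
apply: (lt_le_trans a0); apply: lb_le_inf.
  exists (Num.sqrt (a ^+ 2)), (a ^+ 2) => //=.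
  move/eigenvalueP: ea => [v vX v0]; apply/eigenvalueP; exists v => //.
  by rewrite sX mulmxA vX -scalemxAl vX scalerA.
move=> _ [b /= /(eigenvalue_symmetricP (trmx_gram X))[z zb z1] <-].
have eb : b = dot (X *m z) (X *m z) by rewrite -dot_gram zb dotZr z1 mulr1.
have b0 : 0 <= b by rewrite eb dot_ge0.
have a0' := ltW a0.
rewrite -ler_sqr ?nnegrE ?sqrtr_ge0// sqr_sqrtr//.
have h := ha z; rewrite z1 mulr1 in h.
have := dot_schwarz z (X *m z); rewrite z1 mul1r -eb => zX; apply: le_trans zX.
by rewrite ler_sqr ?nnegrE// (le_trans _ h).
Qed.

Lemma posdef_form_ge0 n (X : 'M[R]_n) (x : 'cV[R]_n) : posdefmx X -> 0 <= dot x (X *m x).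
Proof.
move=> [_ X0]; have [->|x0] := eqVneq x 0; first by rewrite dot0l.
have := X0 x x0; have -> : (x^T *m X *m x) ord0 ord0 = dot x (X *m x).
  by rewrite /dot mulmxA /mxtrace big_ord1.
exact: ltW.
Qed.

Lemma sigma_min_le_spectral_norm n (X : 'M[R]_n) : (0 < n)%N -> posdefmx X ->
  sigma_min X <= spectral_norm X.
Proof.
move=> n0 pX; have [x x1] := exists_unit_vector n0.
have := sigma_min_psd pX.1 (fun x => posdef_form_ge0 x pX) x.
by have := dot_spectral_norm1 X x; rewrite x1 !mulr1 => a b; exact: le_trans b a.
Qed.

End rayleigh_quotient.

(** * Spectral radius and powers of a matrix *)

Section powers.
Variable R : realType.
Local Notation C := (complex R).
Local Notation normc := (@ComplexField.Normc.normc R).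

Lemma normc_ge0 (z : C) : 0 <= normc z.
Proof. by case: z => a b; exact: sqrtr_ge0. Qed.

Lemma normcD (x y : C) : normc (x + y) <= normc x + normc y.
Proof. exact: (@le_normcD R x y). Qed.

Lemma normc_real (x : R) : normc (real_complex R x) = `|x|.
Proof. by rewrite /= expr0n/= addr0 sqrtr_sqr. Qed.

Lemma normc_sum (I : Type) (s : seq I) (F : I -> C) :
  normc (\sum_(i <- s) F i) <= \sum_(i <- s) normc (F i).
Proof.
elim/big_rec2 : _ => [|i y x _ h]; first by rewrite ComplexField.Normc.normc0.
by apply: le_trans (normcD _ _) _; rewrite lerD2l.
Qed.

Definition geometric_bound n (Y : nat -> 'M[C]_n) (r : R) : Prop :=
  exists2 c, 0 <= c & forall t i j, normc (Y t i j) <= c * r ^+ t.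

(** The solution is a convolution of W with the powers of z. A constant c' works
    as soon as it dominates the initial value and c <= c' (r - |z|), which is
    exactly what the induction step needs. *)
Lemma geometric_bound_recurrence n (Y W : nat -> 'M[C]_n) (z : C) (r : R) :
  normc z < r -> (forall t, Y t.+1 = z *: Y t + W t) ->
  geometric_bound W r -> geometric_bound Y r.
Proof.
move=> zr YW [c c0 hW].
pose y0 := \sum_i \sum_j normc (Y 0%N i j).
have y00 : 0 <= y0 by do 2!apply: sumr_ge0 => ? _; exact: normc_ge0.
have r0 : 0 < r by apply: le_lt_trans zr; exact: normc_ge0.
have d0 : 0 < r - normc z by rewrite subr_gt0.
pose c' := y0 + c / (r - normc z).
have c'0 : 0 <= c' by rewrite addr_ge0// divr_ge0// ltW.
exists c' => //; elim => [|t IH] i j.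
  rewrite expr0 mulr1 /c' -[leLHS]addr0 lerD ?divr_ge0 ?(ltW d0)//.
  rewrite /y0 (bigD1 i)//= (bigD1 j)//= -addrA lerDl addr_ge0//.
    by apply: sumr_ge0 => ? _; exact: normc_ge0.
  by do 2!apply: sumr_ge0 => ? _; exact: normc_ge0.
rewrite YW !mxE; apply: le_trans (normcD _ _) _.
rewrite ComplexField.Normc.normcM.
apply: (@le_trans _ _ (normc z * (c' * r ^+ t) + c * r ^+ t)).
  by apply: lerD => //; rewrite ler_wpM2l// normc_ge0.
rewrite exprS mulrCA mulrA [c' * _]mulrC mulrA -mulrDl.
have rt : 0 <= r ^+ t by rewrite exprn_ge0// ltW.
apply: ler_wpM2r => //.
have : c <= c' * (r - normc z).
  by rewrite /c' mulrDl divfK ?gt_eqF// lerDr mulr_ge0// ltW.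
rewrite mulrBr; lra.
Qed.

Lemma eigenvalue_list n (A : 'M[C]_n.+1) : exists rs : seq C,
  horner_mx A (\prod_(z <- rs) ('X - z%:P)) = 0 /\
  forall z, eigenvalue A z = (z \in rs).
Proof.
have [rs E] := closed_field_poly_normal (char_poly A); exists rs.
move: E; rewrite (monicP (char_poly_monic A)) scale1r => E.
split; first by rewrite -E Cayley_Hamilton.
by move=> z; rewrite eigenvalue_root_char E root_prod_XsubC.
Qed.

(** By Cayley-Hamilton the powers satisfy a linear recurrence with
    characteristic roots the eigenvalues; the factors A - z are peeled off one at a time. *)
Lemma geometric_bound_power n (A : 'M[C]_n.+1) (r : R) :
  (forall z, eigenvalue A z -> normc z < r) ->
  geometric_bound (fun t => A ^+ t) r.
Proof.
move=> hr; have [rs [h0 ev]] := eigenvalue_list A.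
suff H : forall s q, {subset s <= rs} ->
    horner_mx A (q * \prod_(z <- s) ('X - z%:P)) = 0 ->
    geometric_bound (fun t => A ^+ t * horner_mx A q) r.
  have := H rs 1 (fun x h => h); rewrite mul1r => /(_ h0).
  by rewrite rmorph1 => -[c c0 hc]; exists c => // t i j; have := hc t i j; rewrite mulr1.
elim => [|z s IH] q sub.
  rewrite big_nil mulr1 => ->; exists 0 => // t i j.
  by rewrite mulr0 mxE mul0r ComplexField.Normc.normc0.
rewrite big_cons mulrA => /IH h.
apply: (@geometric_bound_recurrence _ _
  (fun t => A ^+ t * horner_mx A (q * ('X - z%:P))) z).
- by apply: hr; rewrite ev; apply: sub; rewrite mem_head.
- move=> t; rewrite rmorphM rmorphB /= horner_mx_X horner_mx_C.
  have -> : A ^+ t * (horner_mx A q * (A - z%:M)) =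
      A ^+ t * (horner_mx A q * A) - z *: (A ^+ t * horner_mx A q).
    have e : horner_mx A q * z%:M = z *: horner_mx A q by exact: mul_mx_scalar.
    by rewrite !mulrBr e scalerAr.
  rewrite addrC subrK exprSr -mulrA; congr (_ * _).
  by rewrite -[X in X * _ = _]horner_mx_X -rmorphM mulrC rmorphM /= horner_mx_X.
- by apply: h => x xs; apply: sub; rewrite inE xs orbT.
Qed.

Lemma spectral_radius_ub n (A : 'M[R]_n) z :
  eigenvalue (map_mx (real_complex R) A) z -> normc z <= spectral_radius A.
Proof.
case: n A => [|n] A; first by move=> /eigenvalueP[v _]; rewrite (thinmx0 v) eqxx.
have [rs [_ ev]] := eigenvalue_list (map_mx (real_complex R) A).
move=> ez; apply: ub_le_sup; last by exists z.
exists (\sum_(w <- rs) normc w) => _ [w /= ew <-].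
rewrite ev in ew; rewrite (big_rem w)//= lerDl.
by apply: sumr_ge0 => ? _; exact: normc_ge0.
Qed.

Definition mxpow n (A : 'M[R]_n) t : 'M[R]_n := iter t (mulmx A) 1%:M.

Lemma mxpowS n (A : 'M[R]_n) t : mxpow A t.+1 = A *m mxpow A t.
Proof. by []. Qed.

Lemma map_mxpow n (A : 'M[R]_n.+1) t :
  map_mx (real_complex R) (mxpow A t) = map_mx (real_complex R) A ^+ t.
Proof.
elim: t => [|t IH]; first by rewrite map_mx1.
by rewrite mxpowS map_mxM IH exprS.
Qed.

Lemma mxpow_geometric n (A : 'M[R]_n) : spectral_radius A < 1 ->
  exists2 c, 0 <= c & exists2 r, 0 <= r < 1 & forall t i j, `|mxpow A t i j| <= c * r ^+ t.
Proof.
case: n A => [|n] A rA; first by exists 0 => //; exists 0 => [|t []//]; rewrite lexx ltr01.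
pose r := Num.max 0 ((1 + spectral_radius A) / 2).
have r01 : 0 <= r < 1 by rewrite /r le_max lexx gt_max ltr01 /=; lra.
have [|c c0 h] := @geometric_bound_power _ (map_mx (real_complex R) A) r.
  by move=> z /spectral_radius_ub zr; rewrite /r lt_max; apply/orP; right; lra.
exists c => //; exists r => // t i j; have := h t i j.
by rewrite -map_mxpow mxE normc_real.
Qed.

(** Read v A^t = z^t v at an entry of the left eigenvector v of largest modulus. *)
Lemma eigenvalue_small_power n (A : 'M[R]_n) t (q : R) z :
  (forall i j, `|mxpow A t i j| <= q) -> eigenvalue (map_mx (real_complex R) A) z ->
  normc z ^+ t <= n%:R * q.
Proof.
move=> hq /eigenvalueP[v vA v0].
have vAt : v *m map_mx (real_complex R) (mxpow A t) = z ^+ t *: v.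
  elim: (t) => [|k IH]; first by rewrite expr0 scale1r map_mx1 mulmx1.
  by rewrite mxpowS map_mxM mulmxA vA -scalemxAl IH scalerA exprS.
have /rV0Pn[j0 _] := v0.
pose j := [arg max_(k > j0) normc (v 0 k)]%O.
have jmax k : normc (v 0 k) <= normc (v 0 j).
  by rewrite /j; case: arg_maxP => // i _ /(_ k isT).
have vj : 0 < normc (v 0 j).
  rewrite lt_def normc_ge0 andbT; apply: contra v0 => /eqP vj0.
  apply/eqP/rowP => k; rewrite mxE; apply: ComplexField.Normc.eq0_normc.
  by apply/eqP; rewrite eq_le normc_ge0 -vj0 jmax.
have nX : normc z ^+ t = normc (z ^+ t).
  elim: (t) => [|k IH]; first by rewrite !expr0 ComplexField.Normc.normc1.
  by rewrite !exprS ComplexField.Normc.normcM IH.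
rewrite -(ler_pM2r vj) nX -ComplexField.Normc.normcM.
have <- : (z ^+ t *: v) 0 j = z ^+ t * v 0 j by rewrite mxE.
rewrite -vAt mxE; apply: le_trans (normc_sum _ _) _.
apply: (@le_trans _ _ (\sum_(k < n) normc (v 0 j) * q)).
  apply: ler_sum => k _; rewrite ComplexField.Normc.normcM mxE normc_real.
  by apply: ler_pM => //; exact: normc_ge0.
by rewrite sumr_const card_ord -mulrnAr -mulr_natl mulrC.
Qed.

(** All eigenvalues have modulus less than 1; being finitely many, they stay
    away from 1. *)
Lemma small_power_stable n (A : 'M[R]_n) t (q : R) :
  (forall i j, `|mxpow A t i j| <= q) -> n%:R * q < 1 -> spectral_radius A < 1.
Proof.
move=> hq q1; case: n A hq q1 => [|n] A hq q1.
  rewrite /spectral_radius; set S := [set _ | _ in _].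
  have -> : S = set0.
    by rewrite -subset0 => x [z /= /eigenvalueP[v _]]; rewrite (thinmx0 v) eqxx.
  by rewrite sup0.
have [rs [_ ev]] := eigenvalue_list (map_mx (real_complex R) A).
have lt1 z : z \in rs -> normc z < 1.
  rewrite -ev => /(eigenvalue_small_power hq) h; rewrite ltNge; apply/negP => z1.
  by have := le_lt_trans h q1; rewrite ltNge exprn_ege1.
apply: (@le_lt_trans _ _ (\big[Num.max/0]_(z <- rs) normc z)); last first.
  by rewrite big_seq; elim/big_ind : _ => // x y x1 y1; rewrite gt_max x1 y1.
have le0 : 0 <= \big[Num.max/0]_(z <- rs) normc z.
  by elim/big_ind : _ => // [x y x1 y1|z _]; rewrite ?le_max ?x1// normc_ge0.
rewrite /spectral_radius; set S := [set _ | _ in _].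
have ubS : ubound S (\big[Num.max/0]_(z <- rs) normc z).
  move=> _ [z /= + <-]; rewrite ev; elim: (rs) => // w s IH.
  by rewrite inE big_cons le_max => /orP[/eqP ->|/IH ->]; rewrite ?lexx ?orbT.
have [S0|] := pselect (S !=set0); first exact: ge_sup.
by move=> /set0P/negP; rewrite negbK => /eqP ->; rewrite sup0.
Qed.

End powers.

(** * The Stein equation *)

Section stein_equation.
Variable R : realType.

Definition steinmx n (A : 'M[R]_n) : 'M[R]_(n * n) :=
  1%:M - lin_mx (mulmxr A \o mulmx A^T).

(** The solution X of X = A^T X A + S, when it is unique. Cramer's rule makes it
    a rational function of the entries of A and S, which is how
    differentiability in the gain is obtained. *)
Definition lyap n (A S : 'M[R]_n) : 'M[R]_n :=
  vec_mx (mxvec S *m ((\det (steinmx A))^-1 *: \adj (steinmx A))).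

Lemma mxvec_steinmx n (A X : 'M[R]_n) :
  mxvec X *m steinmx A = mxvec (X - A^T *m X *m A).
Proof. by rewrite /steinmx mulmxBr mulmx1 mul_vec_lin /= linearB. Qed.

Lemma lyapE n (A S : 'M[R]_n) : \det (steinmx A) != 0 ->
  lyap A S = vec_mx (mxvec S *m invmx (steinmx A)).
Proof. by move=> d0; rewrite /lyap /invmx unitmxE unitfE d0. Qed.

Lemma lyap_fix n (A S : 'M[R]_n) : \det (steinmx A) != 0 ->
  lyap A S = A^T *m lyap A S *m A + S.
Proof.
move=> d0; apply/eqP; rewrite addrC -subr_eq; apply/eqP.
apply: (can_inj mxvecK); rewrite -mxvec_steinmx lyapE// vec_mxK mulmxKV//.
by rewrite unitmxE unitfE.
Qed.

Lemma lyap_unique n (A S X : 'M[R]_n) : \det (steinmx A) != 0 ->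
  X = A^T *m X *m A + S -> X = lyap A S.
Proof.
move=> d0 h; rewrite lyapE//; have -> : S = X - A^T *m X *m A by rewrite {1}h addrC addKr.
by rewrite -mxvec_steinmx mulmxK ?mxvecK// unitmxE unitfE.
Qed.

Lemma lyapD n (A S S' : 'M[R]_n) : lyap A (S + S') = lyap A S + lyap A S'.
Proof. by rewrite /lyap linearD mulmxDl linearD. Qed.

Lemma lyapZ n (A S : 'M[R]_n) a : lyap A (a *: S) = a *: lyap A S.
Proof. by rewrite /lyap [mxvec (a *: S)]linearZ /= -scalemxAl linearZ. Qed.

Lemma lyapN n (A S : 'M[R]_n) : lyap A (- S) = - lyap A S.
Proof. by rewrite -scaleN1r lyapZ scaleN1r. Qed.

Lemma lyapB n (A S S' : 'M[R]_n) : lyap A (S - S') = lyap A S - lyap A S'.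
Proof. by rewrite lyapD lyapN. Qed.

Section stable.
Variables (n : nat) (A : 'M[R]_n).
Hypothesis A_stable : spectral_radius A < 1.

Lemma mxpow_form_cvg0 (X : 'M[R]_n) p (x y : 'M[R]_(n, p)) :
  (fun t => dot (mxpow A t *m x) (X *m (mxpow A t *m y))) @ \oo --> (0 : R).
Proof.
have [c c0 [r /andP[r0 r1] h]] := mxpow_geometric A_stable.
pose D := (n%:R * c) ^+ 2 * (frobenius_norm x * (frobenius_norm X * frobenius_norm y)).
have nA t : frobenius_norm (mxpow A t) <= n%:R * c * r ^+ t.
  have rt : 0 <= r ^+ t by rewrite exprn_ge0.
  rewrite -ler_sqr ?nnegrE ?frobenius_norm_ge0 ?mulr_ge0//.
  rewrite sqr_frobenius_norm dotE.
  apply: (@le_trans _ _ (\sum_(i < n) \sum_(j < n) (c * r ^+ t) ^+ 2)).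
    do 2!(apply: ler_sum => ? _); rewrite -expr2 -real_normK ?num_real//.
    by rewrite ler_sqr ?nnegrE ?normr_ge0 ?mulr_ge0 ?h.
  rewrite !sumr_const card_ord -mulrnA -[leLHS]mulr_natr natrM le_eqVlt; apply/orP; left; apply/eqP.
  ring.
have le t : `|dot (mxpow A t *m x) (X *m (mxpow A t *m y))| <= D * r ^+ t.
  apply: le_trans (dot_frobenius _ _) _.
  have rt : 0 <= r ^+ t by rewrite exprn_ge0.
  apply: (@le_trans _ _ ((n%:R * c * r ^+ t * frobenius_norm x) *
     (frobenius_norm X * (n%:R * c * r ^+ t * frobenius_norm y)))).
    apply: ler_pM; rewrite ?frobenius_norm_ge0//.
      apply: le_trans (frobenius_normM _ _) _.
      by rewrite ler_wpM2r ?frobenius_norm_ge0.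
    apply: le_trans (frobenius_normM _ _) _; rewrite ler_wpM2l ?frobenius_norm_ge0//.
    apply: le_trans (frobenius_normM _ _) _.
    by rewrite ler_wpM2r ?frobenius_norm_ge0.
  have -> : (n%:R * c * r ^+ t * frobenius_norm x) *
     (frobenius_norm X * (n%:R * c * r ^+ t * frobenius_norm y)) =
     D * r ^+ t * r ^+ t by rewrite /D; ring.
  apply: ler_piMr; last by apply: exprn_ile1 => //; exact: ltW.
  apply: mulr_ge0 => //; apply: mulr_ge0; first exact: sqr_ge0.
  by rewrite !mulr_ge0 ?frobenius_norm_ge0.
have g0 : (fun t => D * r ^+ t) @ \oo --> (0 : R).
  by apply: cvg_geometric; rewrite ger0_norm.
apply: (@squeeze_cvgr _ _ _ _ (fun t => - (D * r ^+ t)) (fun t => D * r ^+ t)) => //.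
  by near=> t; rewrite -ler_norml.
by rewrite -oppr0; exact: cvgN.
Unshelve. all: by end_near. Qed.

Lemma mxpow_fix (X : 'M[R]_n) (t : nat) :
  X = A^T *m X *m A -> X = (mxpow A t)^T *m X *m mxpow A t.
Proof.
move=> h; elim: t => [|t IH]; first by rewrite trmx1 mul1mx mulmx1.
by rewrite mxpowS trmx_mul !mulmxA -(mulmxA _ A^T) -(mulmxA _ _ A) -h.
Qed.

(** A fixed point X of X |-> A^T X A equals (A^t)^T X A^t for all t, and the
    powers of A tend to 0. *)
Lemma det_steinmx_neq0 : \det (steinmx A) != 0.
Proof.
rewrite -unitfE -unitmxE -row_free_unit; apply/row_freeP; exists (invmx (steinmx A)).
apply: mulmxV; rewrite -row_free_unit -kermx_eq0; apply/rowV0P => v /sub_kermxP.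
rewrite -(vec_mxK v) mxvec_steinmx; set X := vec_mx v.
move=> /(congr1 vec_mx); rewrite mxvecK linear0 => /eqP; rewrite subr_eq0 => /eqP h.
suff -> : X = 0 by rewrite linear0.
apply/matrixP => i j; rewrite [RHS]mxE.
have E t : X i j = dot (mxpow A t *m delta_mx i (0 : 'I_1)) (X *m (mxpow A t *m delta_mx j 0)).
  rewrite dot_adjoint !mulmxA -mxpow_fix// /dot /mxtrace big_ord1 trmx_delta.
  by rewrite -rowE -colE !mxE.
have := @mxpow_form_cvg0 X _ (delta_mx i (0 : 'I_1)) (delta_mx j 0).
under eq_cvg do rewrite -E.
by move=> /(cvg_lim (@Rhausdorff _)); rewrite lim_cst.
Qed.

Lemma lyap_partial_sum (S : 'M[R]_n) t :
  lyap A S = \sum_(k < t) (mxpow A k)^T *m S *m mxpow A k +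
             (mxpow A t)^T *m lyap A S *m mxpow A t.
Proof.
elim: t => [|t IH]; first by rewrite big_ord0 add0r trmx1 mul1mx mulmx1.
rewrite {1}IH big_ord_recr /= -addrA; congr (_ + _).
rewrite {1}(lyap_fix S det_steinmx_neq0) mulmxDr mulmxDl [LHS]addrC; congr (_ + _).
by rewrite trmx_mul !mulmxA.
Qed.

Lemma lyap_series p (S : 'M[R]_n) (x : 'M[R]_(n, p)) :
  (fun t => \sum_(k < t) dot (mxpow A k *m x) (S *m (mxpow A k *m x))) @ \oo -->
  dot x (lyap A S *m x).
Proof.
have E t : \sum_(k < t) dot (mxpow A k *m x) (S *m (mxpow A k *m x)) =
   dot x (lyap A S *m x) - dot (mxpow A t *m x) (lyap A S *m (mxpow A t *m x)).
  rewrite {1}(lyap_partial_sum S t) mulmxDl dotDr.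
  rewrite [X in _ + X - _](_ : _ = dot (mxpow A t *m x) (lyap A S *m (mxpow A t *m x))).
    rewrite addrK mulmx_suml /dot mulmx_sumr raddf_sum /=; apply: eq_bigr => k _.
    by rewrite trmx_mul !mulmxA.
  by rewrite /dot trmx_mul !mulmxA.
under eq_cvg do rewrite E.
have := cvgB (cvg_cst (dot x (lyap A S *m x))) (mxpow_form_cvg0 (lyap A S) x x).
by rewrite subr0; apply.
Qed.

(** The solution is the limit of sums of the nonnegative forms of
    (A^k)^T S A^k. *)
Lemma lyap_psd p (S : 'M[R]_n) : (forall x : 'M[R]_(n, p), 0 <= dot x (S *m x)) ->
  forall x : 'M[R]_(n, p), 0 <= dot x (lyap A S *m x).
Proof.
move=> S0 x; rewrite -(cvg_lim (@Rhausdorff _) (lyap_series (S := S) (x := x))).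
apply: limr_ge; first by apply/cvg_ex; exists (dot x (lyap A S *m x)); exact: lyap_series.
by near=> t; apply: sumr_ge0.
Unshelve. all: by end_near. Qed.

Lemma lyap_tr (S : 'M[R]_n) : (lyap A S)^T = lyap A S^T.
Proof.
apply: lyap_unique; first exact: det_steinmx_neq0.
by rewrite {1}(lyap_fix S det_steinmx_neq0) linearD /= !trmx_mul trmxK mulmxA.
Qed.

End stable.

End stein_equation.

(** * Derivatives of matrix-valued functions *)

Section matrix_derivatives.
Variables (R : realType) (U : normedModType R).
Implicit Types (x v : U).

Lemma near_eq_differentiable (W : normedModType R) (f g : U -> W) x :
  (\forall u \near x, f u = g u) -> differentiable f x -> differentiable g x.
Proof.
move=> fg df; have fgx : f x = g x by exact: nbhs_singleton fg.
have [c e] := (diff_locallyP x f).1 df.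
have e' : g \o shift x = cst (g x) + 'd f x +o_ 0 id.
  apply/eqaddoP => eps eps0.
  have /eqaddoP/(_ eps eps0) := e.
  have fg0 : \forall h \near 0, f (h + x) = g (h + x).
    by move: fg; rewrite (near_shift 0 x); apply: filterS => h /=; rewrite subr0.
  move=> h; near=> z.
  have -> : (g \o shift x - (cst (g x) + 'd f x)) z = (f \o shift x - (cst (f x) + 'd f x)) z.
    rewrite fgx; rewrite /= !fctE /=; congr (_ - _).
    by symmetry; near: z.
  by near: z.
have du := diff_unique c e'.
by apply/diff_locallyP; rewrite du.
Unshelve. all: by end_near. Qed.

Lemma differentiable_bigsum (I : Type) (s : seq I) (P : pred I) (F : I -> U -> R) x :
  (forall i, differentiable (F i) x) ->
  differentiable (fun u => \sum_(i <- s | P i) F i u) x.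
Proof.
move=> h; elim: s => [|i s IH].
  by under eq_fun do rewrite big_nil; exact: differentiable_cst.
under eq_fun do rewrite big_cons.
by case: (P i) => //; exact: (differentiableD (h i) IH).
Qed.

Lemma differentiable_bigprod (I : Type) (s : seq I) (P : pred I) (F : I -> U -> R) x :
  (forall i, differentiable (F i) x) ->
  differentiable (fun u => \prod_(i <- s | P i) F i u) x.
Proof.
move=> h; elim: s => [|i s IH].
  by under eq_fun do rewrite big_nil; exact: differentiable_cst.
under eq_fun do rewrite big_cons.
by case: (P i) => //; exact: (differentiableM (h i) IH).
Qed.

Definition mxdiff m n (F : U -> 'M[R]_(m, n)) x : Prop :=
  forall i j, differentiable (fun u => F u i j) x.

Definition mxder m n (F : U -> 'M[R]_(m, n)) x v : 'M[R]_(m, n) :=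
  \matrix_(i, j) 'D_v (fun u => F u i j) x.

Lemma mxdiff_cst m n (M : 'M[R]_(m, n)) x : mxdiff (fun _ => M) x.
Proof. by move=> i j; exact: differentiable_cst. Qed.

Lemma mxder_cst m n (M : 'M[R]_(m, n)) x v : mxder (fun _ => M) x v = 0.
Proof. by apply/matrixP => i j; rewrite !mxE; exact: derive_cst. Qed.

Lemma mxdiff_tr m n (F : U -> 'M[R]_(m, n)) x : mxdiff F x -> mxdiff (fun u => (F u)^T) x.
Proof. by move=> h i j; under eq_fun do rewrite mxE; exact: h. Qed.

Lemma mxder_tr m n (F : U -> 'M[R]_(m, n)) x v :
  mxder (fun u => (F u)^T) x v = (mxder F x v)^T.
Proof.
by apply/matrixP => i j; rewrite !mxE; congr (derive _ x v); apply/funext => u; rewrite mxE.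
Qed.

Lemma mxdiffD m n (F G : U -> 'M[R]_(m, n)) x : mxdiff F x -> mxdiff G x ->
  mxdiff (fun u => F u + G u) x.
Proof.
by move=> f g i j; under eq_fun do rewrite mxE; exact: (differentiableD (f i j) (g i j)).
Qed.

Lemma mxderD m n (F G : U -> 'M[R]_(m, n)) x v : mxdiff F x -> mxdiff G x ->
  mxder (fun u => F u + G u) x v = mxder F x v + mxder G x v.
Proof.
move=> f g; apply/matrixP => i j; rewrite !mxE.
rewrite -deriveD; [|exact: diff_derivable|exact: diff_derivable].
by congr (derive _ x v); apply/funext => u; rewrite mxE.
Qed.

Lemma mxdiffN m n (F : U -> 'M[R]_(m, n)) x : mxdiff F x -> mxdiff (fun u => - F u) x.
Proof. by move=> f i j; under eq_fun do rewrite mxE; exact: (differentiableN (f i j)). Qed.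

Lemma mxderN m n (F : U -> 'M[R]_(m, n)) x v : mxdiff F x ->
  mxder (fun u => - F u) x v = - mxder F x v.
Proof.
move=> f; apply/matrixP => i j; rewrite !mxE.
rewrite -deriveN; last exact: diff_derivable.
by congr (derive _ x v); apply/funext => u; rewrite mxE.
Qed.

Lemma mxdiffB m n (F G : U -> 'M[R]_(m, n)) x : mxdiff F x -> mxdiff G x ->
  mxdiff (fun u => F u - G u) x.
Proof. by move=> f g; apply: mxdiffD => //; exact: mxdiffN. Qed.

Lemma mxderB m n (F G : U -> 'M[R]_(m, n)) x v : mxdiff F x -> mxdiff G x ->
  mxder (fun u => F u - G u) x v = mxder F x v - mxder G x v.
Proof. by move=> f g; rewrite mxderD ?mxderN//; exact: mxdiffN. Qed.

Lemma mxdiffM m n k (F : U -> 'M[R]_(m, n)) (G : U -> 'M[R]_(n, k)) x :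
  mxdiff F x -> mxdiff G x -> mxdiff (fun u => F u *m G u) x.
Proof.
move=> f g i j; under eq_fun do rewrite mxE.
by apply: differentiable_bigsum => l; exact: (differentiableM (f i l) (g l j)).
Qed.

Lemma mxderM m n k (F : U -> 'M[R]_(m, n)) (G : U -> 'M[R]_(n, k)) x v :
  mxdiff F x -> mxdiff G x ->
  mxder (fun u => F u *m G u) x v = mxder F x v *m G x + F x *m mxder G x v.
Proof.
move=> f g; apply/matrixP => i j; rewrite !mxE -big_split /=.
have fd a b : derivable (fun u => F u a b) x v by exact: diff_derivable.
have gd a b : derivable (fun u => G u a b) x v by exact: diff_derivable.
transitivity (\sum_(l < n) 'D_v ((fun u => F u i l) * (fun u => G u l j)) x).
  rewrite -derive_sum; last by move=> l; exact: derivableM.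
  by congr (derive _ x v); apply/funext => u; rewrite mxE fct_sumE.
apply: eq_bigr => l _; rewrite deriveM// !mxE /GRing.scale /= addrC.
by congr (_ + _); rewrite mulrC.
Qed.

Lemma differentiable_det n (F : U -> 'M[R]_n) x : mxdiff F x ->
  differentiable (fun u => \det (F u)) x.
Proof.
move=> f; rewrite /determinant; apply: differentiable_bigsum => s.
apply: (differentiableM (differentiable_cst _ _)).
by apply: differentiable_bigprod => i; exact: f.
Qed.

Lemma mxdiff_adj n (F : U -> 'M[R]_n) x : mxdiff F x -> mxdiff (fun u => \adj (F u)) x.
Proof.
move=> f i j; under eq_fun do rewrite mxE /cofactor.
apply: (differentiableM (differentiable_cst _ _)); apply: differentiable_det => k l.
by under eq_fun do rewrite !mxE; exact: f.
Qed.

Lemma mxdiff_lin m n p q (L : {linear 'M[R]_(m, n) -> 'M[R]_(p, q)}) (F : U -> 'M[R]_(m, n)) x :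
  mxdiff F x -> mxdiff (fun u => L (F u)) x.
Proof.
move=> f i j.
have -> : (fun u => L (F u) i j) =
   fun u => \sum_k \sum_l F u k l * L (delta_mx k l) i j.
  apply/funext => u; rewrite {1}(matrix_sum_delta (F u)) linear_sum summxE.
  apply: eq_bigr => k _; rewrite linear_sum summxE; apply: eq_bigr => l _.
  by rewrite linearZ mxE.
apply: differentiable_bigsum => k; apply: differentiable_bigsum => l.
by apply: (differentiableM (f k l)); exact: differentiable_cst.
Qed.

Lemma mxdiff_steinmx n (F : U -> 'M[R]_n) x : mxdiff F x -> mxdiff (fun u => steinmx (F u)) x.
Proof.
move=> f; apply: mxdiffB; first exact: mxdiff_cst.
move=> i j; under eq_fun do rewrite mxE /=.
have : mxdiff (fun u => mxvec ((F u)^T *m vec_mx (delta_mx 0 i) *m F u)) x.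
  apply: mxdiff_lin; apply: mxdiffM => //; apply: mxdiffM; first exact: mxdiff_tr.
  exact: mxdiff_cst.
by move=> /(_ 0 j); under eq_fun do rewrite /=.
Qed.

Lemma mxdiff_lyap n (F S : U -> 'M[R]_n) x : \det (steinmx (F x)) != 0 ->
  mxdiff F x -> mxdiff S x -> mxdiff (fun u => lyap (F u) (S u)) x.
Proof.
move=> d0 f s; apply: mxdiff_lin; apply: mxdiffM; first exact: mxdiff_lin.
move=> i j; under eq_fun do rewrite mxE.
apply: differentiableM; last exact/mxdiff_adj/mxdiff_steinmx.
by apply: differentiableV => //; apply: differentiable_det; exact: mxdiff_steinmx.
Qed.

(** The equation X = A^T X A + S holds on a neighborhood, where the determinant
    does not vanish. The product rule turns it into an equation of the same
    kind for the derivative of X, and uniqueness identifies the solution. *)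
Lemma mxder_lyap n (F S : U -> 'M[R]_n) x v : \det (steinmx (F x)) != 0 ->
  mxdiff F x -> mxdiff S x ->
  mxder (fun u => lyap (F u) (S u)) x v =
  lyap (F x) ((mxder F x v)^T *m lyap (F x) (S x) *m F x +
              (F x)^T *m lyap (F x) (S x) *m mxder F x v + mxder S x v).
Proof.
move=> d0 f s; have dl := mxdiff_lyap d0 f s.
have nd : \forall u \near x, \det (steinmx (F u)) != 0.
  have := differentiable_continuous (differentiable_det (mxdiff_steinmx f)).
  move=> /(_ [set y | y != 0]) /=; apply.
  apply: open_nbhs_nbhs; split => //; exact: open_neq.
set X := fun u => lyap (F u) (S u).
have dFX : mxdiff (fun u => (F u)^T *m X u) x by apply: mxdiffM => //; exact: mxdiff_tr.
have dFXF : mxdiff (fun u => (F u)^T *m X u *m F u) x by apply: mxdiffM.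
apply: lyap_unique => //.
rewrite [LHS](_ : mxder X x v = mxder (fun u => (F u)^T *m X u *m F u + S u) x v); last first.
  apply/matrixP => i j; rewrite !mxE; apply: near_eq_derive.
  by near=> u; rewrite {1}/X lyap_fix//; near: u.
rewrite mxderD// mxderM// mxderM//; last exact: mxdiff_tr.
rewrite mxder_tr mulmxDl -/X -/(X x); set a := _ *m _ *m _; set b := _ *m _ *m _.
by rewrite [a + b]addrC -!addrA.
Unshelve. all: by end_near. Qed.

End matrix_derivatives.

(** * The cost as a trace *)

Section cost_formula.
Variables (R : realType) (disp : measure_display) (Omega : measurableType disp).
Variables (P : probability Omega R) (n m d : nat) (S : sof_lqr P n m d).
Hypothesis x_init_L2 : forall i, (x_init S i : Omega -> R) \in Lfun P 2%:E.
Local Notation X0 := (second_moment S).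

Definition initial_state (w : Omega) : 'cV[R]_n := \col_i x_init S i w.

Definition control_cost (K : 'M[R]_(m, d)) : 'M[R]_n :=
  (K *m Cmx S)^T *m Rmx S *m (K *m Cmx S).

Definition stage_weight (K : 'M[R]_(m, d)) : 'M[R]_n := Qmx S + control_cost K.

Lemma dot_mulmxE k (M : 'M[R]_k) (x : 'cV[R]_k) :
  dot x (M *m x) = \sum_i \sum_j M i j * (x i 0 * x j 0).
Proof.
rewrite dotE; apply: eq_bigr => i _; rewrite big_ord1 mxE mulr_sumr.
by apply: eq_bigr => j _; ring.
Qed.

Lemma products_integrable i j :
  P.-integrable setT (EFin \o (x_init S i \* x_init S j : Omega -> R)).
Proof. by apply/Lfun1_integrable; exact: Lfun2_mul_Lfun1. Qed.

Lemma second_momentE i j :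
  (\int[P]_w (x_init S i w * x_init S j w)%:E = (X0 i j)%:E)%E.
Proof.
rewrite mxE fineK; first by rewrite unlock.
by apply: expectation_fin_num; exact: Lfun2_mul_Lfun1.
Qed.

Lemma integral_form (M : 'M[R]_n) :
  (\int[P]_w (dot (initial_state w) (M *m initial_state w))%:E = (\tr (M *m X0))%:E)%E.
Proof.
have int i j : P.-integrable setT (fun w => (M i j * (x_init S i w * x_init S j w))%:E).
  under eq_fun do rewrite EFinM.
  by apply: integrableZl => //; exact: products_integrable.
under eq_integral => w _.
  rewrite dot_mulmxE -sumEFin.
  under eq_bigr => i _.
    rewrite -sumEFin.
    under eq_bigr => j _ do rewrite !mxE.
    over.
  over.
rewrite integral_sum//=; last by move=> i; exact: integrable_sum.
rewrite /mxtrace -sumEFin; apply: eq_bigr => i _.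
rewrite integral_sum//= mxE -sumEFin; apply: eq_bigr => j _.
under eq_integral do rewrite EFinM.
rewrite integralZl//; last exact: products_integrable.
by rewrite second_momentE -EFinM; congr (_ * _)%:E; rewrite !mxE; congr (fine (expectation _ _)); apply/funext => w /=; rewrite mulrC.
Qed.

Lemma stateE K w t : state S K w t = mxpow (closed_loop S K) t *m initial_state w.
Proof.
rewrite /state; elim: t => [|t IH]; first by rewrite /= mul1mx.
by rewrite iterS IH mxpowS mulmxA.
Qed.

Lemma stage_costE K (x : 'cV[R]_n) : stage_cost S K x = dot x (stage_weight K *m x).
Proof.
by rewrite /stage_cost /dot /mxtrace big_ord1 /stage_weight /control_cost trmx_mul !mulmxA.
Qed.

Hypothesis (Q_posdef : posdefmx (Qmx S)) (R_posdef : posdefmx (Rmx S)).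

Lemma dot_control_cost K k (x : 'M[R]_(n, k)) :
  dot x (control_cost K *m x) = dot (K *m Cmx S *m x) (Rmx S *m (K *m Cmx S *m x)).
Proof. by rewrite [RHS]dot_adjoint /control_cost !mulmxA. Qed.

Lemma control_cost_ge0 K (x : 'cV[R]_n) : 0 <= dot x (control_cost K *m x).
Proof. by rewrite dot_control_cost posdef_form_ge0. Qed.

Lemma stage_weight_ge0 K (x : 'cV[R]_n) : 0 <= dot x (stage_weight K *m x).
Proof. by rewrite mulmxDl dotDr addr_ge0 ?control_cost_ge0 ?posdef_form_ge0. Qed.

Lemma measurable_form (M : 'M[R]_n) :
  measurable_fun setT (fun w : Omega => dot (initial_state w) (M *m initial_state w) : R).
Proof.
under eq_fun do rewrite dot_mulmxE.
apply: measurable_sum => i; apply: measurable_sum => j.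
apply: measurable_funM; first exact: measurable_cst.
under eq_fun do rewrite !mxE.
exact: measurable_funM.
Qed.

Definition value_matrix (K : 'M[R]_(m, d)) : 'M[R]_n :=
  lyap (closed_loop S K) (stage_weight K).

(** Monotone convergence exchanges expectation and sum; the partial sums of
    (A^k)^T (Q + C^T K^T R K C) A^k telescope to P_K minus a vanishing term. *)
Lemma costE K : stabilizing S K -> cost S K = \tr (value_matrix K *m X0).
Proof.
move=> sK; rewrite /cost.
pose A := closed_loop S K.
pose M k := (mxpow A k)^T *m stage_weight K *m mxpow A k.
have E w t : stage_cost S K (state S K w t) = dot (initial_state w) (M t *m initial_state w).
  by rewrite stage_costE stateE dot_adjoint /M !mulmxA.
have M0 w t : (0 <= (dot (initial_state w) (M t *m initial_state w))%:E)%E.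
  by rewrite lee_fin -E stage_costE stage_weight_ge0.
under eq_integral => w _.
  under eq_eseriesr => t _ do rewrite E.
  over.
rewrite integral_nneseries//; last by move=> t; apply/measurable_EFinP; exact: measurable_form.
under eq_eseriesr => t _ do rewrite integral_form.
have Mc : (fun t => \tr ((mxpow A t)^T *m value_matrix K *m mxpow A t *m X0)) @ \oo --> (0 : R).
  have -> : (fun t => \tr ((mxpow A t)^T *m value_matrix K *m mxpow A t *m X0)) =
     fun t => dot (mxpow A t *m 1%:M) (value_matrix K *m (mxpow A t *m X0)).
    by apply/funext => t; rewrite mulmx1 /dot !mulmxA.
  exact: mxpow_form_cvg0.
have lim : (fun t => \sum_(0 <= k < t) (\tr (M k *m X0))%:E)%E @ \oo -->
    (\tr (value_matrix K *m X0))%:E.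
  have -> : (fun t => \sum_(0 <= k < t) (\tr (M k *m X0))%:E)%E = fun t =>
      (\tr (value_matrix K *m X0) - \tr ((mxpow A t)^T *m value_matrix K *m mxpow A t *m X0))%:E.
    apply/funext => t; rewrite sumEFin big_mkord; congr EFin.
    rewrite {1}/value_matrix (lyap_partial_sum sK (stage_weight K) t) mulmxDl mxtraceD.
    by rewrite addrK mulmx_suml raddf_sum.
  apply: cvg_EFin; first by near=> t.
  have := cvgB (cvg_cst (\tr (value_matrix K *m X0))) Mc.
  by rewrite subr0; apply.
by rewrite (cvg_lim _ lim).
Unshelve. all: by end_near. Qed.

Lemma trmx_second_moment : X0^T = X0.
Proof.
apply/matrixP => i j; rewrite !mxE; congr (fine (expectation _ _)).
by apply/funext => w /=; rewrite mulrC.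
Qed.

(** The trace is the expectation of x^T M x. *)
Lemma mxtrace_psd (M : 'M[R]_n) : (forall x : 'cV[R]_n, 0 <= dot x (M *m x)) ->
  0 <= \tr (M *m X0).
Proof.
move=> M0; rewrite -lee_fin -integral_form.
by apply: integral_ge0 => w _; rewrite lee_fin.
Qed.

Lemma second_moment_ge0 (x : 'cV[R]_n) : 0 <= dot x (X0 *m x).
Proof.
have -> : dot x (X0 *m x) = \tr ((x *m x^T) *m X0).
  by rewrite /dot mulmxA mxtrace_mulC mulmxA.
apply: mxtrace_psd => y; rewrite /dot -mulmxA mulmxA -[y^T *m x]trmxK trmx_mul trmxK.
exact: dot_ge0.
Qed.

Lemma second_moment_ge_mu (x : 'cV[R]_n) : mu S * dot x x <= dot x (X0 *m x).
Proof.
by apply: sigma_min_psd; [exact: trmx_second_moment | exact: second_moment_ge0].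
Qed.

(** With y = M x, Cauchy-Schwarz makes M dominate y y^T / (x^T M x), whose
    trace against X0 is at least mu |y|^2 / (x^T M x) >= mu x^T M x. *)
Lemma mxtrace_ge_mu (M : 'M[R]_n) (x : 'cV[R]_n) : 0 <= mu S -> M^T = M ->
  (forall x : 'cV[R]_n, 0 <= dot x (M *m x)) ->
  dot x x = 1 -> mu S * dot x (M *m x) <= \tr (M *m X0).
Proof.
move=> mu0 sM M0 x1; have := M0 x; rewrite le_eqVlt => /orP[/eqP <-|k0].
  by rewrite mulr0; exact: mxtrace_psd.
set k := dot x (M *m x) in k0 *; pose y := M *m x.
have D : 0 <= \tr ((M - k^-1 *: (y *m y^T)) *m X0).
  apply: mxtrace_psd => z.
  rewrite mulmxBl dotBr subr_ge0 -scalemxAl dotZr ler_pdivrMl//.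
  have -> : dot z (y *m y^T *m z) = dot x (M *m z) ^+ 2.
    have e : dot x (M *m z) = (y^T *m z) 0 0.
      by rewrite /y trmx_mul sM -mulmxA /dot /mxtrace big_ord1.
    rewrite e expr2 /dot -mulmxA mulmxA /mxtrace big_ord1 mxE big_ord1; congr (_ * _).
    by rewrite -[z^T *m y]trmxK trmx_mul trmxK mxE.
  have := @dominated_schwarz _ _ 1 M M 1 sM sM ler01 _ x z; rewrite expr1n mul1r; apply.
  by move=> u; rewrite mul1r ger0_norm.
move: D; rewrite mulmxBl linearB /= subr_ge0; apply: le_trans.
rewrite -scalemxAl mxtraceZ.
have -> : \tr (y *m y^T *m X0) = dot y (X0 *m y).
  by rewrite /dot mulmxA [RHS]mxtrace_mulC mulmxA.
rewrite ler_pdivlMl//; apply: le_trans (second_moment_ge_mu y).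
have := dot_schwarz x y; rewrite x1 mul1r -/k expr2 => h.
by rewrite mulrCA ler_wpM2l.
Qed.

End cost_formula.

(** * Directional derivatives of the cost *)

Section more_matrix_derivatives.
Variables (R : realType) (U : normedModType R).

Lemma mxdiffMl m n k (M : 'M[R]_(m, n)) (F : U -> 'M[R]_(n, k)) x :
  mxdiff F x -> mxdiff (fun u => M *m F u) x.
Proof. by move=> f; apply: mxdiffM => //; exact: mxdiff_cst. Qed.

Lemma mxderMl m n k (M : 'M[R]_(m, n)) (F : U -> 'M[R]_(n, k)) x v :
  mxdiff F x -> mxder (fun u => M *m F u) x v = M *m mxder F x v.
Proof.
by move=> f; rewrite (mxderM v (mxdiff_cst M x) f) mxder_cst mul0mx add0r.
Qed.

Lemma mxdiffMr m n k (M : 'M[R]_(n, k)) (F : U -> 'M[R]_(m, n)) x :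
  mxdiff F x -> mxdiff (fun u => F u *m M) x.
Proof. by move=> f; apply: mxdiffM => //; exact: mxdiff_cst. Qed.

Lemma mxderMr m n k (M : 'M[R]_(n, k)) (F : U -> 'M[R]_(m, n)) x v :
  mxdiff F x -> mxder (fun u => F u *m M) x v = mxder F x v *m M.
Proof.
by move=> f; rewrite (mxderM v f (mxdiff_cst M x)) mxder_cst mulmx0 addr0.
Qed.

End more_matrix_derivatives.

Section cost_derivatives.
Variables (R : realType) (disp : measure_display) (Omega : measurableType disp).
Variables (P : probability Omega R) (n m d : nat) (S : sof_lqr P n m d).
Hypothesis x_init_L2 : forall i, (x_init S i : Omega -> R) \in Lfun P 2%:E.
Hypotheses (Q_posdef : posdefmx (Qmx S)) (R_posdef : posdefmx (Rmx S)).

Local Notation X0 := (second_moment S).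
Local Notation Rm := (Rmx S).
Local Notation A := (closed_loop S).
Local Notation PK := (value_matrix S).
Local Notation C := (Cmx S).
Implicit Types K V W : 'M[R]_(m, d).

Definition sym (X : 'M[R]_n) := X + X^T.

Lemma trmx_sym X : (sym X)^T = sym X.
Proof. by rewrite /sym linearD /= trmxK addrC. Qed.

Lemma dot_sym X (x : 'cV[R]_n) : dot x (sym X *m x) = 2 * dot x (X *m x).
Proof. by rewrite /sym mulmxDl dotDr -dot_adjoint dotC mulr2n mulrDl !mul1r. Qed.

(** The closed loop A_K = A - B K C has derivative - B V C along V. Hence each
    directional derivative of the solution P_K of
    P = A_K^T P A_K + Q + C^T K^T R K C solves an equation of the same kind; src1,
    src2 and src3 are the sources for the first, second and (twice along V, once
    along W) third derivatives dP, d2P and lyap A_K src3. *)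
Definition loop_dir V : 'M[R]_n := Bmx S *m V *m C.

Definition src1 K V := sym ((V *m C)^T *m (Rm *m (K *m C)) - (loop_dir V)^T *m (PK K *m A K)).

Definition dP K V := lyap (A K) (src1 K V).

Definition src2 K V W := sym ((V *m C)^T *m (Rm *m (W *m C))
  + (loop_dir V)^T *m (PK K *m loop_dir W)
  - (loop_dir V)^T *m (dP K W *m A K) - (loop_dir W)^T *m (dP K V *m A K)).

Definition d2P K V W := lyap (A K) (src2 K V W).

Definition src3 K V W := sym ((loop_dir V)^T *m (dP K W *m loop_dir V)
  + 2 *: ((loop_dir V)^T *m (dP K V *m loop_dir W))
  - 2 *: ((loop_dir V)^T *m (d2P K V W *m A K)) - (loop_dir W)^T *m (d2P K V V *m A K)).

Lemma trmx_stage_weight K : (stage_weight S K)^T = stage_weight S K.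
Proof.
rewrite /stage_weight /control_cost linearD /= Q_posdef.1 !trmx_mul !trmxK R_posdef.1.
by rewrite !mulmxA.
Qed.


(** Differentiating the outer factors of A^T P A adds a symmetric contribution to
    the source. *)
Lemma stein_source (A0 D P0 X : 'M[R]_n) : P0^T = P0 ->
  (- D)^T *m P0 *m A0 + A0^T *m P0 *m (- D) + sym X = sym (X - D^T *m (P0 *m A0)).
Proof.
move=> sP; rewrite /sym [(X - _)^T]linearB /= !trmx_mul trmxK sP [(- D)^T]linearN /= !mulNmx !mulmxN -!mulmxA.
by rewrite addrC addrACA.
Qed.

(** The two symmetric cross terms of the second source coincide when both
    directions do; this is the product rule for them. *)
Lemma second_difference (E D P1 P2 A0 X : 'M[R]_n) :
  X - E *m (P2 *m A0 + P1 *m (- D)) - E *m (P2 *m A0 + P1 *m (- D)) =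
  X + 2 *: (E *m (P1 *m D)) - 2 *: (E *m (P2 *m A0)).
Proof.
rewrite mulmxDr mulmxN [E *m - _]mulmxN; set e := E *m (P2 *m A0); set f := E *m (P1 *m D).
by rewrite !scaler_nat !mulr2n !opprB opprD -!addrA; congr (_ + (_ + _)); rewrite addrCA.
Qed.

Section at_stable_gain.
Variable K : 'M[R]_(m, d).
Hypothesis K_stable : stabilizing S K.

Lemma trmx_value_matrix : (PK K)^T = PK K.
Proof. by rewrite /value_matrix lyap_tr// trmx_stage_weight. Qed.

Lemma trmx_dP V : (dP K V)^T = dP K V.
Proof. by rewrite /dP lyap_tr// trmx_sym. Qed.

Lemma trmx_d2P V W : (d2P K V W)^T = d2P K V W.
Proof. by rewrite /d2P lyap_tr// trmx_sym. Qed.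

Lemma mxdiff_id : mxdiff (fun K => K) K.
Proof. by move=> i j; exact: differentiable_coord. Qed.

Lemma mxder_id W : mxder (fun K : 'M[R]_(m, d) => K) K W = W.
Proof.
rewrite -[RHS](@derive_id R _ K W) derive_mx //; exact: derivable_id.
Qed.

Lemma mxdiff_gain : mxdiff (fun K => K *m C) K.
Proof. exact/mxdiffMr/mxdiff_id. Qed.

Lemma mxder_gain W : mxder (fun K => K *m C) K W = W *m C.
Proof. by rewrite mxderMr ?mxder_id//; exact: mxdiff_id. Qed.

Lemma mxdiff_closed_loop : mxdiff A K.
Proof.
apply: mxdiffB; first exact: mxdiff_cst.
exact/mxdiffMr/mxdiffMl/mxdiff_id.
Qed.

Lemma mxder_closed_loop W : mxder A K W = - loop_dir W.
Proof.
rewrite /closed_loop mxderB; [|exact: mxdiff_cst|exact/mxdiffMr/mxdiffMl/mxdiff_id].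
rewrite mxder_cst sub0r mxderMr; last exact/mxdiffMl/mxdiff_id.
by rewrite mxderMl ?mxder_id//; exact: mxdiff_id.
Qed.

Lemma mxdiff_stage_weight : mxdiff (stage_weight S) K.
Proof.
apply: mxdiffD; first exact: mxdiff_cst.
apply: mxdiffM; last exact: mxdiff_gain.
exact/mxdiffMr/mxdiff_tr/mxdiff_gain.
Qed.

Lemma mxder_stage_weight W : mxder (stage_weight S) K W =
  sym ((W *m C)^T *m (Rm *m (K *m C))).
Proof.
have g := mxdiff_gain; have gt := mxdiff_tr g.
rewrite /stage_weight mxderD; [|exact: mxdiff_cst|by apply: mxdiffM => //; exact: mxdiffMr].
rewrite mxder_cst add0r /control_cost mxderM//; last exact: mxdiffMr.
rewrite mxderMr// mxder_tr mxder_gain /sym !trmx_mul !trmxK R_posdef.1.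
by rewrite !mulmxA.
Qed.

Let dA := mxdiff_closed_loop.
Let dt := det_steinmx_neq0 K_stable.

Lemma mxdiff_value_matrix : mxdiff PK K.
Proof. by apply: mxdiff_lyap => //; exact: mxdiff_stage_weight. Qed.


Lemma mxder_value_matrix W : mxder PK K W = dP K W.
Proof.
rewrite mxder_lyap//; last exact: mxdiff_stage_weight.
rewrite -/(PK K) mxder_closed_loop mxder_stage_weight /dP /src1; congr lyap.
by rewrite stein_source ?trmx_value_matrix.
Qed.

Let dPK := mxdiff_value_matrix.

Lemma mxdiff_src1 V : mxdiff (fun K => src1 K V) K.
Proof.
have h : mxdiff (fun K => (V *m C)^T *m (Rm *m (K *m C)) - (loop_dir V)^T *m (PK K *m A K)) K.
  apply: mxdiffB; first exact/mxdiffMl/mxdiffMl/mxdiff_gain.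
  exact/mxdiffMl/mxdiffM.
by apply: mxdiffD => //; exact: mxdiff_tr.
Qed.

Lemma mxdiff_dP V : mxdiff (fun K => dP K V) K.
Proof. by apply: mxdiff_lyap => //; exact: mxdiff_src1. Qed.

Lemma mxder_src1 V W : mxder (fun K => src1 K V) K W =
  sym ((V *m C)^T *m (Rm *m (W *m C)) + (loop_dir V)^T *m (PK K *m loop_dir W)
       - (loop_dir V)^T *m (dP K W *m A K)).
Proof.
have g := mxdiff_gain.
have h1 : mxdiff (fun K => (V *m C)^T *m (Rm *m (K *m C))) K by do 2!apply: mxdiffMl.
have h2 : mxdiff (fun K => PK K *m A K) K by exact: mxdiffM.
have h3 : mxdiff (fun K => (loop_dir V)^T *m (PK K *m A K)) K by exact: mxdiffMl.
have h := mxdiffB h1 h3.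
rewrite /src1 /sym mxderD//; last exact: mxdiff_tr.
rewrite mxder_tr mxderB// mxderMl; last exact: mxdiffMl.
rewrite mxderMl// mxder_gain mxderMl// mxderM// mxder_value_matrix mxder_closed_loop.
by rewrite mulmxN mulmxDr mulmxN opprD opprK addrA addrAC.
Qed.

Lemma mxder_dP V W : mxder (fun K => dP K V) K W = d2P K V W.
Proof.
rewrite mxder_lyap//; last exact: mxdiff_src1.
rewrite mxder_src1 mxder_closed_loop -/(dP K V) /d2P /src2; congr lyap.
by rewrite stein_source ?trmx_dP.
Qed.

Lemma mxdiff_src2 V W : mxdiff (fun K => src2 K V W) K.
Proof.
have h : mxdiff (fun K => (V *m C)^T *m (Rm *m (W *m C))
  + (loop_dir V)^T *m (PK K *m loop_dir W)
  - (loop_dir V)^T *m (dP K W *m A K) - (loop_dir W)^T *m (dP K V *m A K)) K.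
  apply: mxdiffB; last by apply/mxdiffMl/mxdiffM => //; exact: mxdiff_dP.
  apply: mxdiffB; last by apply/mxdiffMl/mxdiffM => //; exact: mxdiff_dP.
  apply: mxdiffD; first exact: mxdiff_cst.
  exact/mxdiffMl/mxdiffMr.
by apply: mxdiffD => //; exact: mxdiff_tr.
Qed.

Lemma mxdiff_d2P V W : mxdiff (fun K => d2P K V W) K.
Proof. by apply: mxdiff_lyap => //; exact: mxdiff_src2. Qed.

Lemma mxder_src2 V W : mxder (fun K => src2 K V V) K W =
  sym ((loop_dir V)^T *m (dP K W *m loop_dir V)
       + 2 *: ((loop_dir V)^T *m (dP K V *m loop_dir W))
       - 2 *: ((loop_dir V)^T *m (d2P K V W *m A K))).
Proof.
have h1 : mxdiff (fun K => (V *m C)^T *m (Rm *m (V *m C))) K by exact: mxdiff_cst.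
have h2 : mxdiff (fun K => PK K *m loop_dir V) K by exact: mxdiffMr.
have h3 := mxdiffMl (loop_dir V)^T h2.
have h4 : mxdiff (fun K => dP K V *m A K) K by apply: mxdiffM => //; exact: mxdiff_dP.
have h5 := mxdiffMl (loop_dir V)^T h4.
have h6 := mxdiffD h1 h3; have h7 := mxdiffB h6 h5; have h8 := mxdiffB h7 h5.
rewrite /src2 /sym mxderD//; last exact: mxdiff_tr.
rewrite mxder_tr mxderB// mxderB// mxderD// mxder_cst mxderMl// mxderMr//.
rewrite mxderMl// mxderM//; last exact: mxdiff_dP.
rewrite mxder_dP mxder_value_matrix mxder_closed_loop.
by rewrite add0r second_difference.
Qed.

Lemma mxder_d2P V W : mxder (fun K => d2P K V V) K W = lyap (A K) (src3 K V W).
Proof.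
rewrite mxder_lyap//; last exact: mxdiff_src2.
rewrite /src3 -(stein_source _ _ _ (trmx_d2P V V)); congr (lyap _ _).
by congr (_ + _); [rewrite mxder_closed_loop|exact: mxder_src2].
Qed.

End at_stable_gain.

Lemma symD X Y : sym (X + Y) = sym X + sym Y.
Proof. by rewrite /sym [(X + Y)^T]linearD /= addrACA. Qed.

Lemma symZ a X : sym (a *: X) = a *: sym X.
Proof. by rewrite /sym [(a *: X)^T]linearZ /= scalerDr. Qed.

Lemma loop_dirD V W : loop_dir (V + W) = loop_dir V + loop_dir W.
Proof. by rewrite /loop_dir mulmxDr mulmxDl. Qed.

Lemma loop_dirZ a V : loop_dir (a *: V) = a *: loop_dir V.
Proof. by rewrite /loop_dir -scalemxAr -scalemxAl. Qed.

Lemma src1Z a K V : src1 K (a *: V) = a *: src1 K V.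
Proof.
rewrite /src1 loop_dirZ -scalemxAl [(a *: _)^T]linearZ /= [(a *: loop_dir _)^T]linearZ /=.
by rewrite -!scalemxAl -scalerBr symZ.
Qed.

End cost_derivatives.

(** * Bounds on the second and third derivatives *)

Section third_derivative_constants.
Variable R : realType.
Implicit Types (s p c r k g z : R).

(** Here z bounds the first derivative of P_K relative to P_K, and g the norm of
    A_K. For g >= 6/5 it suffices that z <= z1 and z <= z2, since 6 z <= 5 g z.
    For smaller g the share kap of the cost spent on controls matters: z is at
    most h (sqrt(r kap) + c p g), so a small kap makes z small, while a large kap
    leaves only p - kap for the states. *)
Lemma core_constant_ineq (h c p r kap g b q z z1 z2 : R) :
  0 < h -> 0 <= c -> 0 < p -> 0 <= r -> 0 <= kap -> kap <= p -> 0 <= g ->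
  0 <= b -> b ^+ 2 = r * kap -> 0 <= q -> q ^+ 2 = (r + c ^+ 2 * p) * p ->
  0 <= z -> z <= z1 -> z <= h * (b + c * p * g) -> h * (q + c * p * g) <= z2 ->
  6 * (p - kap) * Num.min g 1 * z <= p * (g * (3 * z1 + 2 * z2)).
Proof.
move=> h0 c0 p0 r0 k0 kp g0 b0 b2 q0 q2 z0 zz1 zc z2q.
have bq : b <= q.
  rewrite -ler_sqr ?nnegrE// b2 q2 mulrDl.
  have := ler_wpM2l r0 kp; have : 0 <= c ^+ 2 * p * p by rewrite !mulr_ge0// ltW.
  lra.
have zz2 : z <= z2.
  apply: le_trans zc _; apply: le_trans z2q; rewrite ler_pM2l//; lra.
have z10 : 0 <= z1 by lra.
have z20 : 0 <= z2 by lra.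
have [gl|gs] := leP (6 / 5) g.
  have m1 : Num.min g 1 <= 1 by rewrite ge_min lexx orbT.
  have m0 : 0 <= Num.min g 1 by rewrite le_min g0 ler01.
  apply: (@le_trans _ _ (6 * p * z)).
    have : (p - kap) * Num.min g 1 <= p * 1 by apply: ler_pM; lra.
    nra.
  have : 6 * z <= g * (3 * z1 + 2 * z2) by nra.
  nra.
have mg : Num.min g 1 <= g by rewrite ge_min lexx.
suff H : 6 * (p - kap) * z <= p * (3 * z1 + 2 * z2).
  apply: (@le_trans _ _ (g * (6 * (p - kap) * z))); last first.
    have := ler_wpM2l g0 H; nra.
  have : 0 <= 6 * (p - kap) * z by rewrite !mulr_ge0//; lra.
  nra.
suff H : (3 * p - 6 * kap) * z <= 2 * p * z2 by nra.
have [sg|sg] := leP (3 * p - 6 * kap) 0.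
  have : (3 * p - 6 * kap) * z <= 0 by nra.
  have : 0 <= p * z2 by nra.
  lra.
apply: (@le_trans _ _ ((3 * p - 6 * kap) * (h * (b + c * p * g)))).
  by rewrite ler_pM2l.
apply: (@le_trans _ _ (2 * p * (h * (q + c * p * g)))); last first.
  by rewrite ler_pM2l// mulr_gt0.
suff H : (3 * p - 6 * kap) * (b + c * p * g) <= 2 * p * (q + c * p * g) by nra.
have cpg : 0 <= c * p * g by rewrite !mulr_ge0// ltW.
suff H : (3 * p - 6 * kap) * b + p * (c * p * g) <= 2 * p * q by nra.
pose t := Num.sqrt (kap / p).
have t0 : 0 <= t by exact: sqrtr_ge0.
have t2 : kap = t ^+ 2 * p.
  by rewrite sqr_sqrtr ?divfK ?gt_eqF// divr_ge0// ltW.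
pose e := Num.sqrt (r * p).
have e0 : 0 <= e by exact: sqrtr_ge0.
have e2 : e ^+ 2 = r * p by rewrite sqr_sqrtr// mulr_ge0// ltW.
have be : b = e * t.
  by apply/eqP; rewrite -(@eqrXn2 _ 2)// ?mulr_ge0// exprMn e2 b2 t2; apply/eqP; ring.
(* 6 t^3 - 3 t + 1 is minimal at t = 1 / sqrt 6, which is close to 2 / 5. *)
have tle : 3 * t - 6 * t ^+ 3 <= 1.
  have : 0 <= (t - 2 / 5) ^+ 2 * t by rewrite mulr_ge0 ?sqr_ge0.
  have : 0 <= (t - 2 / 5) ^+ 2 by rewrite sqr_ge0.
  rewrite !exprS expr0; nra.
have H1 : (3 * p - 6 * kap) * b <= p * e.
  have -> : (3 * p - 6 * kap) * b = p * (e * (3 * t - 6 * t ^+ 3)).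
    by rewrite be t2; ring.
  rewrite ler_pM2l//; nra.
suff H : e + c * p * g <= 2 * q by nra.
have cp0 : 0 <= c * p by rewrite mulr_ge0// ltW.
rewrite -ler_sqr ?nnegrE ?addr_ge0// ?mulr_ge0//.
have -> : (2 * q) ^+ 2 = 4 * (e ^+ 2 + (c * p) ^+ 2) by rewrite exprMn q2 e2; ring.
apply: (@le_trans _ _ ((e + c * p * (6 / 5)) ^+ 2)).
  rewrite ler_sqr ?nnegrE ?addr_ge0 ?mulr_ge0//; nra.
have := sqr_ge0 (e * (6 / 5) - c * p); have := sqr_ge0 e; have := sqr_ge0 (c * p).
nra.
Qed.

(** The left-hand side is the estimate obtained for the third derivative, with Xi
    the trace of the accumulated second moment of the states. In the right-hand
    side the last summand contains z1 g only once, so the comparison is not term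
    by term: the deficit is made up by z2 and by the factor p - kap. *)
Lemma third_derivative_constant_ineq (s nu nB nC p nR kap g b q z z1 z2 alpha Xi : R) :
  let c := nB * nC in let r := nC ^+ 2 * nR in let h := 2 / s in
  0 < s -> 0 < nu -> 0 <= nB -> 0 <= nC -> 0 < p -> 0 <= nR -> 0 <= kap -> kap <= p ->
  0 <= g -> 0 <= b -> b ^+ 2 = r * kap -> 0 <= q -> q ^+ 2 = (r + c ^+ 2 * p) * p ->
  0 <= z -> z <= z1 -> z <= h * (b + c * p * g) -> h * (q + c * p * g) <= z2 ->
  nu * p = alpha -> 0 <= Xi -> s * Xi <= nu * (p - kap) ->
  6 * p * c * (h * (r + c ^+ 2 * p + 2 * c * p * z * Num.min g 1) + c * z) * Xi <=
  2 * alpha ^+ 2 / (nu * s) * nB * nC * ((2 * z1 + z2) * nB * nC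
    + 2 * (h * (nC ^+ 2 * nR + nC * nB * (nC * nB + z1 * g + z2 * g) * p))
    + h * (nC ^+ 2 * nR + nC * nB * (nC * nB + z1 * g) * p)).
Proof.
move=> c r h s0 nu0 nB0 nC0 p0 nR0 kap0 kp g0 b0 b2 q0 q2 z0 zz1 zc z2q alphaE Xi0 XiS.
have h0 : 0 < h by rewrite /h divr_gt0.
have c0 : 0 <= c by exact: mulr_ge0.
have r0 : 0 <= r by apply: mulr_ge0 => //; exact: sqr_ge0.
have core := core_constant_ineq h0 c0 p0 r0 kap0 kp g0 b0 b2 q0 q2 z0 zz1 zc z2q.
have zz2 : z <= z2.
  apply: le_trans zc _; apply: le_trans z2q; rewrite ler_pM2l// lerD2r.
  rewrite -ler_sqr ?nnegrE// b2 q2 mulrDl -[leLHS]addr0; apply: lerD.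
    exact: ler_wpM2l.
  by apply: mulr_ge0 (ltW p0); apply: mulr_ge0 (ltW p0); exact: sqr_ge0.
have m0 : 0 <= Num.min g 1 by rewrite le_min g0 ler01.
move: (Num.min g 1) m0 core => g1 m0 core.
have c2p : 0 <= c ^+ 2 * p by apply: mulr_ge0 (ltW p0); exact: sqr_ge0.
have cp : 0 <= c * p by exact: mulr_ge0 (ltW p0).
pose z3 := h * (r + c ^+ 2 * p + 2 * c * p * z * g1).
have z30 : 0 <= z3.
  apply: mulr_ge0; first exact: ltW.
  have : 0 <= c * p * z * g1 by apply: mulr_ge0 => //; exact: mulr_ge0.
  have -> : 2 * c * p * z * g1 = 2 * (c * p * z * g1) by ring.
  lra.
pose T := (2 * z1 + z2) * c
  + h * (3 * (r + c ^+ 2 * p) + c * p * (g * (3 * z1 + 2 * z2))).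
have main : 3 * (p - kap) * (z3 + c * z) <= p * T.
  have t1 : 3 * (p - kap) * (c * z) <= p * ((2 * z1 + z2) * c).
    have cz : 0 <= c * z by exact: mulr_ge0.
    have a1 : (p - kap) * (c * z) <= p * (c * z) by apply: ler_wpM2r => //; rewrite gerBl.
    have a2 : p * (c * z) <= p * (c * z1) by rewrite ler_pM2l// ler_wpM2l.
    have a3 : p * (c * z) <= p * (c * z2) by rewrite ler_pM2l// ler_wpM2l.
    have -> : p * ((2 * z1 + z2) * c) = 2 * (p * (c * z1)) + p * (c * z2) by ring.
    have -> : 3 * (p - kap) * (c * z) = 3 * ((p - kap) * (c * z)) by ring.
    lra.
  have t2 : 3 * (p - kap) * z3 <=
      p * (h * (3 * (r + c ^+ 2 * p) + c * p * (g * (3 * z1 + 2 * z2)))).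
    have -> : p * (h * (3 * (r + c ^+ 2 * p) + c * p * (g * (3 * z1 + 2 * z2)))) =
      h * (3 * p * (r + c ^+ 2 * p) + c * p * (p * (g * (3 * z1 + 2 * z2)))) by ring.
    have -> : 3 * (p - kap) * z3 =
      h * (3 * (p - kap) * (r + c ^+ 2 * p) + c * p * (6 * (p - kap) * g1 * z)).
      by rewrite /z3; ring.
    rewrite ler_pM2l//; apply: lerD; last exact: ler_wpM2l.
    by apply: ler_wpM2r; [exact: addr_ge0|rewrite ler_pM2l// gerBl].
  by rewrite /T [leLHS]mulrDr [leRHS]mulrDr addrC; apply: lerD.
have -> : 2 * alpha ^+ 2 / (nu * s) * nB * nC * ((2 * z1 + z2) * nB * nC
    + 2 * (h * (nC ^+ 2 * nR + nC * nB * (nC * nB + z1 * g + z2 * g) * p))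
    + h * (nC ^+ 2 * nR + nC * nB * (nC * nB + z1 * g) * p)) =
  2 * c * p * (nu * (p * T)) / s.
  by rewrite -alphaE /T /r /c; field; rewrite !gt_eqF.
rewrite ler_pdivlMr// -/z3.
have -> : 6 * p * c * (z3 + c * z) * Xi * s = 2 * c * p * (3 * (s * Xi) * (z3 + c * z)) by ring.
apply: ler_wpM2l; first by rewrite -mulrA mulr_ge0.
apply: (@le_trans _ _ (3 * (nu * (p - kap)) * (z3 + c * z))).
  apply: ler_wpM2r; last by rewrite ler_pM2l.
  by apply: addr_ge0 => //; exact: mulr_ge0.
have -> : 3 * (nu * (p - kap)) * (z3 + c * z) = nu * (3 * (p - kap) * (z3 + c * z)) by ring.
by rewrite ler_pM2l.
Qed.

Lemma second_derivative_constant_ineq (s nu nB nC p nR kap g z z1 alpha Xi : R) :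
  let c := nB * nC in let r := nC ^+ 2 * nR in
  0 < s -> 0 < nu -> 0 < c -> 0 < p -> 0 <= r -> 0 <= kap ->
  0 <= z -> z <= z1 -> 0 <= g -> nu * p = alpha -> 0 <= Xi -> s * Xi <= nu * (p - kap) ->
  s * (2 / s * (r + c ^+ 2 * p + 2 * c * p * z * Num.min g 1)) * Xi <=
  2 * nC ^+ 2 * (nR + nB ^+ 2 * (1 + 2 * z1 / (nC * nB)) * p) * (alpha / s).
Proof.
move=> c r s0 nu0 c0 p0 r0 kap0 z0 zz1 g0 alphaE Xi0 XiS.
have m0 : 0 <= Num.min g 1 by rewrite le_min g0 ler01.
have m1 : Num.min g 1 <= 1 by rewrite ge_min lexx orbT.
move: (Num.min g 1) m0 m1 => g1 m0 m1.
have cN : c != 0 by rewrite gt_eqF.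
have bN : nB != 0 by apply: contraNneq cN; rewrite /c => ->; rewrite mul0r.
have CN : nC != 0 by apply: contraNneq cN; rewrite /c => ->; rewrite mulr0.
have -> : 2 * nC ^+ 2 * (nR + nB ^+ 2 * (1 + 2 * z1 / (nC * nB)) * p) * (alpha / s) =
  2 * (r + c ^+ 2 * p + 2 * (c * p * z1)) * (alpha / s).
  by rewrite /r /c; field; rewrite bN CN gt_eqF.
have -> : s * (2 / s * (r + c ^+ 2 * p + 2 * c * p * z * g1)) =
  2 * (r + c ^+ 2 * p + 2 * (c * p * (z * g1))) by field; rewrite gt_eqF.
have XiS' : Xi <= alpha / s.
  rewrite ler_pdivlMr// mulrC -alphaE; apply: le_trans XiS _.
  by rewrite ler_pM2l// gerBl.
have cp : 0 <= c * p by rewrite ltW// mulr_gt0.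
have c2p : 0 <= c ^+ 2 * p by rewrite mulr_ge0 ?sqr_ge0// ltW.
have zg0 : 0 <= z * g1 by exact: mulr_ge0.
have zg : z * g1 <= z1 by apply: le_trans zz1; exact: ler_piMr.
have czg : c * p * (z * g1) <= c * p * z1 by exact: ler_wpM2l.
have czg0 : 0 <= c * p * (z * g1) by exact: mulr_ge0.
by apply: ler_pM => //; lra.
Qed.

End third_derivative_constants.

Section cost_bounds.
Opaque cost second_moment spectral_radius lyap frobenius_norm dot.
Variables (R : realType) (disp : measure_display) (Omega : measurableType disp).
Variables (P : probability Omega R) (n m d : nat) (S : sof_lqr P n m d).
Hypothesis x_init_L2 : forall i, (x_init S i : Omega -> R) \in Lfun P 2%:E.
Hypotheses (Q_posdef : posdefmx (Qmx S)) (R_posdef : posdefmx (Rmx S)).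
Hypotheses (n_gt0 : (0 < n)%N) (m_gt0 : (0 < m)%N).

Local Notation X0 := (second_moment S).
Local Notation Rm := (Rmx S).
Local Notation A := (closed_loop S).
Local Notation PK := (value_matrix S).
Local Notation C := (Cmx S).
Local Notation "`‖ X ‖" := (spectral_norm X) (at level 0).

Variables alpha s nu p nB nC nR g z1 z2 : R.
Hypotheses (nu_gt0 : 0 < nu) (sE : s = sigma_min (Qmx S)) (nuE : nu = mu S).
Hypotheses (pE : p = alpha / nu) (gE : g = gamma S alpha).
Hypotheses (nBE : nB = `‖Bmx S‖) (nCE : nC = `‖C‖) (nRE : nR = `‖Rm‖).
Hypotheses (z1E : z1 = zeta1 S alpha) (z2E : z2 = zeta2 S alpha).
Let c := nB * nC.
Let r := nC ^+ 2 * nR.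

Let s_gt0 : 0 < s. Proof. by rewrite sE sigma_min_gt0. Qed.
Let nB_ge0 : 0 <= nB. Proof. by rewrite nBE spectral_norm_ge0. Qed.
Let nC_ge0 : 0 <= nC. Proof. by rewrite nCE spectral_norm_ge0. Qed.
Let nR_ge0 : 0 <= nR. Proof. by rewrite nRE spectral_norm_ge0. Qed.
Let c_ge0 : 0 <= c. Proof. exact: mulr_ge0. Qed.
Let r_ge0 : 0 <= r. Proof. by apply: mulr_ge0 => //; exact: sqr_ge0. Qed.
Let alphaE : nu * p = alpha. Proof. by rewrite pE mulrC divfK// gt_eqF. Qed.

(** This is tr(N Sigma), where Sigma = X0 + A_K Sigma A_K^T is the accumulated
    second moment of the closed-loop states. *)
Definition state_trace (K : 'M[R]_(m, d)) (N : 'M[R]_n) : R := \tr (lyap (A K) N *m X0).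

Definition form_le (N : 'M[R]_n) (a : R) : Prop :=
  forall x : 'cV[R]_n, `|dot x (N *m x)| <= a * dot x x.

Lemma quadratic_dot_scale k (N : 'M[R]_k) (a : R) (x : 'cV[R]_k) :
  dot (a *: x) (N *m (a *: x)) = a ^+ 2 * dot x (N *m x).
Proof. by rewrite -scalemxAr dotZl dotZr mulrA expr2. Qed.


Lemma dot_gain_le (V : 'M[R]_(m, d)) (x : 'cV[R]_n) :
  dot (V *m C *m x) (V *m C *m x) <= (frobenius_norm V * nC) ^+ 2 * dot x x.
Proof.
rewrite -mulmxA exprMn -mulrA; apply: le_trans (sqr_dot_mulmx_le _ _) _.
by rewrite ler_wpM2l ?sqr_ge0// nCE spectral_norm_dot.
Qed.

Lemma dot_loop_dir_le (V : 'M[R]_(m, d)) (x : 'cV[R]_n) :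
  dot (loop_dir S V *m x) (loop_dir S V *m x) <= (c * frobenius_norm V) ^+ 2 * dot x x.
Proof.
rewrite /loop_dir -2!mulmxA; apply: le_trans (spectral_norm_dot _ _) _; rewrite -nBE.
have -> : (c * frobenius_norm V) ^+ 2 * dot x x =
  nB ^+ 2 * ((frobenius_norm V * nC) ^+ 2 * dot x x) by rewrite /c; ring.
by rewrite ler_wpM2l ?sqr_ge0// mulmxA dot_gain_le.
Qed.

Lemma dot_input_weight_le (V W : 'M[R]_(m, d)) (x : 'cV[R]_n) :
  `|dot (V *m C *m x) (Rm *m (W *m C *m x))| <=
  r * frobenius_norm V * frobenius_norm W * dot x x.
Proof.
apply: le_trans (dot_spectral_norm _ _ _) _; rewrite -nRE.
have h (Z : 'M[R]_(m, d)) : frobenius_norm (Z *m C *m x) <=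
   frobenius_norm Z * nC * frobenius_norm x.
  rewrite -ler_sqr ?nnegrE ?mulr_ge0 ?frobenius_norm_ge0//.
  by rewrite [leRHS]exprMn !sqr_frobenius_norm dot_gain_le.
have -> : r * frobenius_norm V * frobenius_norm W * dot x x =
  nR * ((frobenius_norm W * nC * frobenius_norm x) *
           (frobenius_norm V * nC * frobenius_norm x)).
  by rewrite -sqr_frobenius_norm /r; ring.
by apply: ler_wpM2l => //; apply: ler_pM => //; exact: frobenius_norm_ge0.
Qed.

Lemma psd_young k (T : 'M[R]_k) (a b : 'cV[R]_k) : T^T = T ->
  (forall y : 'cV[R]_k, 0 <= dot y (T *m y)) ->
  `|2 * dot a (T *m b)| <= dot a (T *m a) + dot b (T *m b).
Proof.
move=> sT T0; have := T0 (a + b); have := T0 (a - b).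
have sw : dot b (T *m a) = dot a (T *m b) by rewrite dotC dot_adjoint sT.
by rewrite mulmxBr mulmxDr !dotBl !dotBr !dotDl !dotDr sw ler_norml; lra.
Qed.

Let mu_ge0 : 0 <= mu S. Proof. by rewrite -nuE ltW. Qed.

Section at_gain.
Variable K : 'M[R]_(m, d).
Hypotheses (K_stable : stabilizing S K) (K_cost : cost S K <= alpha).

Variable kap : R.
Hypothesis kapE : nu * kap = \tr (control_cost S K *m X0).

Lemma state_traceD N N' : state_trace K (N + N') = state_trace K N + state_trace K N'.
Proof. by rewrite /state_trace lyapD mulmxDl mxtraceD. Qed.

Lemma state_traceZ a N : state_trace K (a *: N) = a * state_trace K N.
Proof. by rewrite /state_trace lyapZ -scalemxAl mxtraceZ. Qed.

Lemma state_traceN N : state_trace K (- N) = - state_trace K N.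
Proof. by rewrite -scaleN1r state_traceZ mulN1r. Qed.

Lemma state_traceB N N' : state_trace K (N - N') = state_trace K N - state_trace K N'.
Proof. by rewrite state_traceD state_traceN. Qed.

Lemma state_trace_ge0 N : (forall x : 'cV[R]_n, 0 <= dot x (N *m x)) ->
  0 <= state_trace K N.
Proof. by move=> N0; apply: mxtrace_psd => //; exact: lyap_psd. Qed.

Lemma state_trace_le N a : form_le N a -> `|state_trace K N| <= a * state_trace K 1%:M.
Proof.
move=> h; rewrite ler_norml; apply/andP; split.
  rewrite -subr_ge0 opprK -state_traceZ -state_traceD; apply: state_trace_ge0 => x.
  rewrite mulmxDl dotDr -scalemxAl mul1mx dotZr.
  by have := h x; rewrite ler_norml => /andP[? _]; lra.
rewrite -subr_ge0 -state_traceZ -state_traceB; apply: state_trace_ge0 => x.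
rewrite mulmxBl dotBr -scalemxAl mul1mx dotZr.
by have := h x; rewrite ler_norml => /andP[_ ?]; lra.
Qed.

Lemma value_matrix_ge0 (x : 'cV[R]_n) : 0 <= dot x (PK K *m x).
Proof. by apply: lyap_psd => // y; exact: stage_weight_ge0. Qed.

Lemma value_matrix_split (x : 'cV[R]_n) : dot x (PK K *m x) =
  dot (A K *m x) (PK K *m (A K *m x)) + (dot x (Qmx S *m x) + dot x (control_cost S K *m x)).
Proof.
rewrite {1}/value_matrix lyap_fix ?det_steinmx_neq0// -/(value_matrix S K).
rewrite [(_ + stage_weight S K) *m x]mulmxDl dotDr [stage_weight S K *m x]mulmxDl dotDr.
by rewrite [dot (A K *m x) _]dot_adjoint !mulmxA.
Qed.

Lemma sigma_Q_le (x : 'cV[R]_n) : s * dot x x <= dot x (Qmx S *m x).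
Proof. by rewrite sE; apply: sigma_min_psd Q_posdef.1 _ x => x; exact: posdef_form_ge0. Qed.

(** The trace of P_K against X0 >= mu I is at most alpha. *)
Lemma value_matrix_le (x : 'cV[R]_n) : dot x (PK K *m x) <= p * dot x x.
Proof.
have [->|x0] := eqVneq x 0; first by rewrite !dot0l mulr0.
have h := mxtrace_ge_mu x_init_L2 mu_ge0 (trmx_value_matrix Q_posdef R_posdef K_stable)
  value_matrix_ge0 (unit_vector x0).
rewrite -costE// in h; have {h} := le_trans h K_cost.
rewrite quadratic_dot_scale exprVn sqr_frobenius_norm -nuE.
have x1 := dot_gt0 x0.
by rewrite mulrCA ler_pdivrMl// -alphaE [leRHS]mulrCA ler_pM2l// [p * _]mulrC.
Qed.

Lemma s_le_p : s <= p.
Proof.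
have [x x1] := exists_unit_vector R n_gt0.
have h := value_matrix_le x; have := value_matrix_split x.
have := sigma_Q_le x; have := value_matrix_ge0 (A K *m x).
have := control_cost_ge0 R_posdef K x; rewrite x1 !mulr1 in h *; lra.
Qed.

Lemma p_gt0 : 0 < p. Proof. exact: lt_le_trans s_le_p. Qed.

Lemma value_matrix_loop_le (x : 'cV[R]_n) :
  dot (A K *m x) (PK K *m (A K *m x)) <= p * dot x x.
Proof.
have := value_matrix_le x; have := value_matrix_split x.
have := control_cost_ge0 R_posdef K x; have := posdef_form_ge0 x Q_posdef; lra.
Qed.

Lemma closed_loop_le : `‖A K‖ <= Num.sqrt (p / s).
Proof.
have ps : 0 <= p / s by rewrite divr_ge0// ltW// p_gt0.
apply: spectral_norm_le => [|x]; first exact: sqrtr_ge0.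
rewrite sqr_sqrtr// mulrAC ler_pdivlMr// mulrC.
apply: le_trans (value_matrix_loop_le x).
have := value_matrix_split (A K *m x); have := sigma_Q_le (A K *m x).
have := value_matrix_ge0 (A K *m (A K *m x)).
have := control_cost_ge0 R_posdef K (A K *m x); lra.
Qed.

Lemma kap_ge0 : 0 <= kap.
Proof.
by rewrite -(pmulr_rge0 _ nu_gt0) kapE; apply: mxtrace_psd => // x; exact: control_cost_ge0.
Qed.

Lemma control_cost_le (x : 'cV[R]_n) : dot x (control_cost S K *m x) <= kap * dot x x.
Proof.
have [->|x0] := eqVneq x 0; first by rewrite !dot0l mulr0.
have sN : (control_cost S K)^T = control_cost S K.
  by rewrite /control_cost !trmx_mul !trmxK R_posdef.1 !mulmxA.
have := mxtrace_ge_mu x_init_L2 mu_ge0 sN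
  (control_cost_ge0 R_posdef K) (unit_vector x0).
rewrite quadratic_dot_scale exprVn sqr_frobenius_norm -nuE.
have x1 := dot_gt0 x0.
by rewrite mulrCA ler_pdivrMl// -kapE [leRHS]mulrCA ler_pM2l// [kap * _]mulrC.
Qed.

(** The cost is tr(Q Sigma) + tr(C^T K^T R K C Sigma). The first term is at
    least s tr(Sigma), the second at least mu kap, as Sigma dominates X0. *)
Lemma state_trace1_le : s * state_trace K 1%:M <= nu * (p - kap).
Proof.
have J : cost S K = state_trace K (Qmx S) + state_trace K (control_cost S K).
  by rewrite costE// -state_traceD.
have h1 : s * state_trace K 1%:M <= state_trace K (Qmx S).
  rewrite -subr_ge0 -state_traceZ -state_traceB; apply: state_trace_ge0 => x.
  by rewrite mulmxBl dotBr -scalemxAl mul1mx dotZr subr_ge0 sigma_Q_le.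
have h2 : \tr (control_cost S K *m X0) <= state_trace K (control_cost S K).
  rewrite /state_trace lyap_fix ?det_steinmx_neq0// mulmxDl mxtraceD lerDr.
  apply: mxtrace_psd => // x; rewrite -2!mulmxA -dot_adjoint.
  by apply: lyap_psd => // y; exact: control_cost_ge0.
have -> : nu * (p - kap) = alpha - \tr (control_cost S K *m X0).
  by rewrite mulrBr alphaE kapE.
move: K_cost h1 h2; rewrite J; lra.
Qed.

Lemma state_trace1_ge0 : 0 <= state_trace K 1%:M.
Proof. by apply: state_trace_ge0 => x; rewrite mul1mx dot_ge0. Qed.

Lemma kap_le_p : kap <= p.
Proof.
have := le_trans (mulr_ge0 (ltW s_gt0) state_trace1_ge0) state_trace1_le.
by rewrite pmulr_rge0// subr_ge0.
Qed.

(** Since s I <= Q <= Q + C^T K^T R K C, the solution with source s I is below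
    P_K. *)
Lemma lyap_le_value_matrix N a : 0 <= a -> form_le N (s * a) ->
  forall x : 'cV[R]_n, `|dot x (lyap (A K) N *m x)| <= a * dot x (PK K *m x).
Proof.
move=> a0 h x.
have sP (M : 'M[R]_n) : (forall y : 'cV[R]_n, dot y (M *m y) <= s * a * dot y y) ->
   dot x (lyap (A K) M *m x) <= a * dot x (PK K *m x).
  move=> hM; rewrite -dotZr scalemxAl -lyapZ -subr_ge0 -dotBr -mulmxBl -lyapB.
  apply: lyap_psd => // y; rewrite mulmxBl dotBr -scalemxAl dotZr subr_ge0.
  apply: le_trans (hM y) _; rewrite [s * a]mulrC -mulrA ler_wpM2l//.
  rewrite mulmxDl dotDr; have := sigma_Q_le y; have := control_cost_ge0 R_posdef K y; lra.
rewrite ler_norml; apply/andP; split.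
  rewrite lerNl -dotNr -mulNmx -lyapN; apply: sP => y; rewrite mulNmx dotNr.
  by have := h y; rewrite ler_norml => /andP[? _]; lra.
by apply: sP => y; have := h y; rewrite ler_norml => /andP[_ ?].
Qed.

Lemma dominated_dot_le N z a b (u v x : 'cV[R]_n) : N^T = N -> 0 <= z -> 0 <= a -> 0 <= b ->
  (forall x : 'cV[R]_n, `|dot x (N *m x)| <= z * dot x (PK K *m x)) ->
  dot u (PK K *m u) <= p * a ^+ 2 * dot x x ->
  dot v (PK K *m v) <= p * b ^+ 2 * dot x x ->
  `|dot u (N *m v)| <= z * (p * a * b) * dot x x.
Proof.
move=> sN z0 a0 b0 h hu hv; have p0 := p_gt0.
have := dominated_schwarz sN (trmx_value_matrix Q_posdef R_posdef K_stable) z0 h u v.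
move=> H; rewrite -mulrA; apply: bilinear_bound => //; last first.
  exact: (mulr_ge0 (mulr_ge0 (mulr_ge0 (ltW p0) a0) b0) (dot_ge0 x)).
apply: le_trans H _; rewrite ler_wpM2l ?sqr_ge0//.
have -> : (p * a * b * dot x x) ^+ 2 =
  (p * a ^+ 2 * dot x x) * (p * b ^+ 2 * dot x x) by ring.
by apply: ler_pM => //; exact: value_matrix_ge0.
Qed.

Lemma value_matrix_loop_dir_le V (x : 'cV[R]_n) :
  dot (loop_dir S V *m x) (PK K *m (loop_dir S V *m x)) <=
  p * (c * frobenius_norm V) ^+ 2 * dot x x.
Proof.
apply: le_trans (value_matrix_le _) _; rewrite -mulrA ler_pM2l ?p_gt0//.
exact: dot_loop_dir_le.
Qed.


End at_gain.


Lemma closed_loop_le_gamma K : sublevel S alpha K -> `‖A K‖ <= g.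
Proof.
move=> sK; rewrite gE; apply: ub_le_sup; last by exists K.
by exists (Num.sqrt (p / s)) => _ [K' [sK' cK'] <-]; exact: closed_loop_le.
Qed.

Section source_bounds.
Variable K : 'M[R]_(m, d).
Hypothesis K_sub : sublevel S alpha K.
Let K_stable := K_sub.1.
Let K_cost := K_sub.2.
Variable kap : R.
Hypothesis kapE : nu * kap = \tr (control_cost S K *m X0).

Lemma gamma_ge0 : 0 <= g.
Proof. exact: le_trans (spectral_norm_ge0 _) (closed_loop_le_gamma K_sub). Qed.

Lemma value_matrix_gamma_le (x : 'cV[R]_n) :
  dot (A K *m x) (PK K *m (A K *m x)) <= p * (Num.min g 1) ^+ 2 * dot x x.
Proof.
rewrite /Num.min; case: ifP => _; last by rewrite expr1n mulr1 value_matrix_loop_le.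
apply: le_trans (value_matrix_le K_stable K_cost _) _.
rewrite -mulrA ler_pM2l ?(p_gt0 K_stable K_cost)//.
apply: le_trans (spectral_norm_dot _ _) _; rewrite ler_wpM2r ?dot_ge0//.
by rewrite ler_sqr ?nnegrE ?spectral_norm_ge0 ?gamma_ge0 ?closed_loop_le_gamma.
Qed.

Lemma dot_src1 V (x : 'cV[R]_n) : dot x (src1 S K V *m x) =
  2 * (dot (V *m C *m x) (Rm *m (K *m C *m x)) -
       dot (loop_dir S V *m x) (PK K *m (A K *m x))).
Proof.
rewrite /src1 dot_sym mulmxBl dotBr; congr (2 * (_ - _)).
  by rewrite [RHS]dot_adjoint !mulmxA.
by rewrite [RHS]dot_adjoint !mulmxA.
Qed.

Lemma unit_form_le_scale (f : 'M[R]_(m, d) -> 'M[R]_n) a :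
  (forall b V, f (b *: V) = b *: f V) ->
  (forall V, frobenius_norm V = 1 -> form_le (f V) a) ->
  forall V, form_le (f V) (a * frobenius_norm V).
Proof.
move=> fZ h V x; have [->|V0] := eqVneq V 0.
  by rewrite -(scale0r 0) fZ scale0r mul0mx dot0r normr0 frobenius_normZ normr0 mul0r mulr0 mul0r.
have v0 : 0 < frobenius_norm V by rewrite lt_def frobenius_norm_eq0 V0 frobenius_norm_ge0.
have -> : V = frobenius_norm V *: ((frobenius_norm V)^-1 *: V).
  by rewrite scalerA mulfV ?scale1r// gt_eqF.
have u1 : frobenius_norm ((frobenius_norm V)^-1 *: V) = 1.
  by rewrite frobenius_normZ (ger0_norm (x := _^-1)) ?invr_ge0 ?(ltW v0)// mulVf// gt_eqF.
have hx := h _ u1 x; move: (_^-1 *: V) u1 hx => V1 u1 hx.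
rewrite fZ -scalemxAl dotZr normrM frobenius_normZ u1 mulr1 !(ger0_norm (ltW v0)).
by rewrite [a * _]mulrC -mulrA ler_wpM2l// ltW.
Qed.

(** Completing squares: the cross terms of the cost of the gain K +- V are
    dominated by the cost of K, which is at most P_K - Q, plus that of V. *)
Lemma src1_zeta1 V : frobenius_norm V = 1 -> form_le (src1 S K V) (s * z1).
Proof.
move=> v1 x; rewrite dot_src1.
have e : s * z1 = (1 + c ^+ 2) * p + r - s.
  rewrite z1E /zeta1 -sE -nuE -pE -nBE -nCE -nRE mulrBr mulr1 mulrA mulfV ?gt_eqF// mul1r.
  by rewrite /c /r exprMn [nB ^+ 2 * _]mulrC.
rewrite e.
have sR : Rm^T = Rm := R_posdef.1.
have sP := trmx_value_matrix Q_posdef R_posdef K_stable.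
have h1 := psd_young (V *m C *m x) (K *m C *m x) sR (fun y => posdef_form_ge0 y R_posdef).
have h2 := psd_young (loop_dir S V *m x) (A K *m x) sP (value_matrix_ge0 K_stable).
have h3 := value_matrix_split K_stable x.
rewrite (dot_control_cost _ K) in h3.
have h4 := value_matrix_le K_stable K_cost x.
have h5 := sigma_Q_le x.
have h6 := value_matrix_loop_dir_le K_stable K_cost V x.
have h7 := dot_input_weight_le V V x.
rewrite v1 !mulr1 in h6 h7.
have h8 := ler_norm (dot (V *m C *m x) (Rm *m (V *m C *m x))).
rewrite mulrBr; apply: le_trans (ler_normB _ _) _.
move: h1 h2 h3 h4 h5 h6 h7 h8; rewrite [p * c ^+ 2]mulrC.
set a1 := `|2 * _|; set a2 := `|2 * _|; lra.
Qed.

Let zc := 2 / s * (Num.sqrt (r * kap) + c * p * g).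

(** Bounding the two cross terms separately: the control part only sees the form
    C^T K^T R K C, which is at most kap. *)
Lemma src1_control V : frobenius_norm V = 1 -> form_le (src1 S K V) (s * zc).
Proof.
move=> v1 x; rewrite dot_src1.
have -> : s * zc = 2 * (Num.sqrt (r * kap) + c * p * g).
  by rewrite /zc; field; rewrite gt_eqF.
rewrite normrM ger0_norm// -[leRHS]mulrA ler_pM2l// mulrDl.
have kap0 := kap_ge0 kapE; have p0 := p_gt0 K_stable K_cost.
apply: le_trans (ler_normB _ _) _; apply: lerD.
  have h := @dominated_schwarz _ _ 1 Rm Rm 1 R_posdef.1 R_posdef.1 ler01 _
    (V *m C *m x) (K *m C *m x).
  apply: bilinear_bound; rewrite ?sqrtr_ge0 ?dot_ge0//.
  rewrite sqr_sqrtr; last exact: (mulr_ge0 r_ge0 kap0).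
  apply: (le_trans (h _)); first by move=> y; rewrite mul1r ger0_norm ?posdef_form_ge0.
  rewrite expr1n mul1r.
  have -> : r * kap * dot x x ^+ 2 = (r * dot x x) * (kap * dot x x) by ring.
  apply: ler_pM; rewrite ?posdef_form_ge0//.
    have := dot_input_weight_le V V x; rewrite v1 !mulr1; apply: le_trans.
    exact: ler_norm.
  by rewrite -dot_control_cost (control_cost_le kapE).
have sP := trmx_value_matrix Q_posdef R_posdef K_stable.
have V0 := value_matrix_ge0 K_stable.
have -> : c * p * g = 1 * (p * c * g) by ring.
apply: (dominated_dot_le K_stable K_cost sP ler01 c_ge0 gamma_ge0).
- by move=> y; rewrite mul1r ger0_norm.
- by have := value_matrix_loop_dir_le K_stable K_cost V x; rewrite v1 mulr1.
- apply: le_trans (value_matrix_gamma_le x) _.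
  rewrite ler_wpM2r ?dot_ge0// ler_pM2l// ler_sqr ?nnegrE ?gamma_ge0//.
    by rewrite ge_min lexx.
  by rewrite le_min gamma_ge0 ler01.
Qed.


Let h := 2 / s.
Let h_gt0 : 0 < h. Proof. by rewrite divr_gt0. Qed.
Let p_pos := p_gt0 K_stable K_cost.
Let q := nC * Num.sqrt ((nR + nB ^+ 2 * p) * p).

Let q_ge0 : 0 <= q. Proof. by apply: mulr_ge0 => //; exact: sqrtr_ge0. Qed.

Let q_sqr : q ^+ 2 = (r + c ^+ 2 * p) * p.
Proof.
rewrite /q exprMn sqr_sqrtr.
  by rewrite /r /c; ring.
apply: mulr_ge0 (ltW p_pos); apply: addr_ge0 => //.
by apply: mulr_ge0 (ltW p_pos); exact: sqr_ge0.
Qed.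

Lemma zeta1_ge0 : 0 <= z1.
Proof.
have e : s * z1 = (1 + c ^+ 2) * p + r - s.
  rewrite z1E /zeta1 -sE -nuE -pE -nBE -nCE -nRE mulrBr mulr1 mulrA mulfV ?gt_eqF// mul1r.
  by rewrite /c /r exprMn [nB ^+ 2 * _]mulrC.
rewrite -(pmulr_rge0 _ s_gt0) e.
have sp := s_le_p K_stable K_cost.
have : 0 <= c ^+ 2 * p by apply: mulr_ge0 (ltW p_pos); exact: sqr_ge0.
move: r_ge0 sp; move: (c ^+ 2) => cc; rewrite mulrDl; lra.
Qed.

(** As |R| >= sigma_min R, the constant q3 times |R| is at least the square root
    in q. *)
Lemma zeta2_ge : h * (q + c * p * g) <= z2.
Proof.
have sR := sigma_min_gt0 m_gt0 R_posdef.
have nR' := sigma_min_le_spectral_norm m_gt0 R_posdef.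
rewrite -nRE in nR'.
have nA := spectral_norm_ge0 (Amx S).
rewrite z2E /zeta2 /q3 -sE -nuE -pE -nBE -nCE -nRE -gE -/h.
move: (sigma_min Rm) (`‖Amx S‖) sR nR' nA => sR nA sR0 sR1 nA0.
rewrite ler_pM2l//; apply: lerD; last first.
  by rewrite /c le_eqVlt; apply/orP; left; apply/eqP; ring.
rewrite /q; set Y := (nR + nB ^+ 2 * p) * p.
have Y0 : 0 <= Y.
  apply: mulr_ge0 (ltW p_pos); apply: addr_ge0 => //.
  by apply: mulr_ge0 (ltW p_pos); exact: sqr_ge0.
have -> : nR * alpha + nB ^+ 2 * alpha ^+ 2 / nu = nu * Y.
  by rewrite /Y -alphaE; field; rewrite gt_eqF.
have sm : Num.sqrt nu != 0 by rewrite gt_eqF// sqrtr_gt0.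
have -> : Num.sqrt (nu * Y) / (Num.sqrt nu * sR) = Num.sqrt Y / sR.
  rewrite sqrtrM; last exact: ltW.
  by field; rewrite sm gt_eqF.
rewrite -mulrA; apply: ler_wpM2l => //.
apply: (@le_trans _ _ (nR * (Num.sqrt Y / sR))).
  by rewrite mulrCA ler_peMr ?sqrtr_ge0// ler_pdivlMr// mul1r.
apply: ler_wpM2l => //; rewrite lerDl; apply: divr_ge0; last by apply: mulr_ge0; exact: ltW.
rewrite -alphaE; apply: mulr_ge0; first exact: mulr_ge0.
by apply: mulr_ge0; exact: ltW.
Qed.

Let z := Num.min z1 zc.

Let zc_ge0 : 0 <= zc.
Proof.
apply: mulr_ge0; first exact: (ltW h_gt0).
apply: addr_ge0; first exact: sqrtr_ge0.
by apply: mulr_ge0 gamma_ge0; apply: mulr_ge0 c_ge0 (ltW p_pos).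
Qed.

Let z_ge0 : 0 <= z. Proof. by rewrite /z le_min zeta1_ge0 zc_ge0. Qed.
Let z_le1 : z <= z1. Proof. by rewrite /z ge_min lexx. Qed.
Let z_lec : z <= zc. Proof. by rewrite /z ge_min lexx orbT. Qed.

Lemma src1_le V : form_le (src1 S K V) (s * z * frobenius_norm V).
Proof.
apply: unit_form_le_scale => {V} [b V|V v1 x]; first exact: src1Z.
rewrite /z /Num.min; case: ifP => _; first exact: src1_zeta1.
exact: src1_control.
Qed.

Lemma dP_le V (x : 'cV[R]_n) :
  `|dot x (dP S K V *m x)| <= z * frobenius_norm V * dot x (PK K *m x).
Proof.
apply: lyap_le_value_matrix => //; first exact: mulr_ge0 z_ge0 (frobenius_norm_ge0 _).
by rewrite mulrA; exact: src1_le.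
Qed.

Let g1 := Num.min g 1.
Let g1_ge0 : 0 <= g1. Proof. by rewrite /g1 le_min gamma_ge0 ler01. Qed.
Let z3 := h * (r + c ^+ 2 * p + 2 * c * p * z * g1).

Let z3_ge0 : 0 <= z3.
Proof.
apply: mulr_ge0; first exact: ltW.
have c2p : 0 <= c ^+ 2 * p by apply: mulr_ge0 (ltW p_pos); exact: sqr_ge0.
have : 0 <= c * p * z * g1.
  apply: mulr_ge0 g1_ge0; apply: mulr_ge0 z_ge0; exact: mulr_ge0 c_ge0 (ltW p_pos).
by move: r_ge0 c2p; rewrite -!mulrA; lra.
Qed.

Lemma dP_cross V W (x : 'cV[R]_n) :
  `|dot (loop_dir S V *m x) (dP S K W *m (A K *m x))| <=
  z * c * p * g1 * (frobenius_norm V * frobenius_norm W) * dot x x.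
Proof.
have w0 := frobenius_norm_ge0 W; have v0 := frobenius_norm_ge0 V.
have sD := trmx_dP K_stable W.
have -> : z * c * p * g1 * (frobenius_norm V * frobenius_norm W) =
  (z * frobenius_norm W) * (p * (c * frobenius_norm V) * g1) by ring.
apply: (dominated_dot_le K_stable K_cost sD) => //.
- exact: mulr_ge0.
- exact: mulr_ge0.
- exact: dP_le.
- exact: value_matrix_loop_dir_le.
- exact: value_matrix_gamma_le.
Qed.

Lemma dot_trmul k (X Y : 'M[R]_(k, n)) (x : 'cV[R]_n) :
  dot x (X^T *m Y *m x) = dot (X *m x) (Y *m x).
Proof. by rewrite dot_adjoint mulmxA. Qed.

Lemma normr_le4 (a b e f a' b' e' f' : R) : `|a| <= a' -> `|b| <= b' -> `|e| <= e' ->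
  `|f| <= f' -> `|a + b - e - f| <= a' + b' + e' + f'.
Proof. rewrite !ler_norml => /andP[? ?] /andP[? ?] /andP[? ?] /andP[? ?]; lra. Qed.

Lemma src2_le V W : form_le (src2 S K V W) (s * (z3 * frobenius_norm V * frobenius_norm W)).
Proof.
move=> x; rewrite /src2 dot_sym normrM ger0_norm//.
rewrite 2!mulmxBl mulmxDl 2!dotBr dotDr.
have -> : s * (z3 * frobenius_norm V * frobenius_norm W) * dot x x =
  2 * (r * frobenius_norm V * frobenius_norm W * dot x x
    + p * (c * frobenius_norm V) * (c * frobenius_norm W) * dot x x
    + z * c * p * g1 * (frobenius_norm V * frobenius_norm W) * dot x x
    + z * c * p * g1 * (frobenius_norm W * frobenius_norm V) * dot x x).
  by rewrite /z3 /h; field; rewrite gt_eqF.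
rewrite ler_pM2l//; apply: normr_le4.
- by rewrite dot_trmul -[Rm *m _ *m x]mulmxA; exact: dot_input_weight_le.
- rewrite dot_trmul -[PK K *m _ *m x]mulmxA.
  rewrite -[X in X * dot x x]mul1r.
  apply: (dominated_dot_le K_stable K_cost
    (trmx_value_matrix Q_posdef R_posdef K_stable) ler01).
  + by apply: mulr_ge0 c_ge0 (frobenius_norm_ge0 _).
  + by apply: mulr_ge0 c_ge0 (frobenius_norm_ge0 _).
  + by move=> y; rewrite mul1r ger0_norm// value_matrix_ge0.
  + exact: value_matrix_loop_dir_le.
  + exact: value_matrix_loop_dir_le.
- by rewrite dot_trmul -[dP S K W *m _ *m x]mulmxA; exact: dP_cross.
- by rewrite dot_trmul -[dP S K V *m _ *m x]mulmxA; exact: dP_cross.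
Qed.

Lemma d2P_le V W (x : 'cV[R]_n) : `|dot x (d2P S K V W *m x)| <=
  z3 * frobenius_norm V * frobenius_norm W * dot x (PK K *m x).
Proof.
apply: lyap_le_value_matrix => //; last exact: src2_le.
by apply: mulr_ge0 (frobenius_norm_ge0 _); apply: mulr_ge0 z3_ge0 (frobenius_norm_ge0 _).
Qed.

Lemma d2P_cross V W U (x : 'cV[R]_n) :
  `|dot (loop_dir S U *m x) (d2P S K V W *m (A K *m x))| <=
  z3 * c * p * (frobenius_norm V * frobenius_norm W * frobenius_norm U) * dot x x.
Proof.
have w0 := frobenius_norm_ge0 W; have v0 := frobenius_norm_ge0 V.
have u0 := frobenius_norm_ge0 U.
have sD := trmx_d2P K_stable V W.
have -> : z3 * c * p * (frobenius_norm V * frobenius_norm W * frobenius_norm U) =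
  (z3 * frobenius_norm V * frobenius_norm W) * (p * (c * frobenius_norm U) * 1) by ring.
apply: (dominated_dot_le K_stable K_cost sD) => //.
- by apply: mulr_ge0 w0; apply: mulr_ge0 z3_ge0 v0.
- exact: mulr_ge0.
- exact: d2P_le.
- exact: value_matrix_loop_dir_le.
- by rewrite expr1n mulr1 value_matrix_loop_le.
Qed.

Lemma dP_loop_dirs V W U (x : 'cV[R]_n) :
  `|dot (loop_dir S V *m x) (dP S K W *m (loop_dir S U *m x))| <=
  z * c ^+ 2 * p * (frobenius_norm V * frobenius_norm W * frobenius_norm U) * dot x x.
Proof.
have w0 := frobenius_norm_ge0 W; have v0 := frobenius_norm_ge0 V.
have u0 := frobenius_norm_ge0 U.
have sD := trmx_dP K_stable W.
have -> : z * c ^+ 2 * p * (frobenius_norm V * frobenius_norm W * frobenius_norm U) =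
  (z * frobenius_norm W) * (p * (c * frobenius_norm V) * (c * frobenius_norm U)) by ring.
apply: (dominated_dot_le K_stable K_cost sD) => //; try exact: mulr_ge0.
- exact: dP_le.
- exact: value_matrix_loop_dir_le.
- exact: value_matrix_loop_dir_le.
Qed.

Lemma src3_le V W : form_le (src3 S K V W)
  (6 * p * c * (z3 + c * z) * (frobenius_norm V ^+ 2 * frobenius_norm W)).
Proof.
move=> x; rewrite /src3 dot_sym normrM ger0_norm//.
rewrite 2!mulmxBl mulmxDl 2!dotBr dotDr -!scalemxAl !dotZr.
set v := frobenius_norm V; set w := frobenius_norm W.
have -> : 6 * p * c * (z3 + c * z) * (v ^+ 2 * w) * dot x x =
  2 * (z * c ^+ 2 * p * (v * w * v) * dot x x
    + 2 * (z * c ^+ 2 * p * (v * v * w) * dot x x)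
    + 2 * (z3 * c * p * (v * w * v) * dot x x)
    + z3 * c * p * (v * v * w) * dot x x) by ring.
rewrite ler_pM2l//; apply: normr_le4.
- by rewrite dot_trmul -[dP S K W *m _ *m x]mulmxA; exact: dP_loop_dirs.
- rewrite normrM ger0_norm// ler_pM2l//.
  by rewrite dot_trmul -[dP S K V *m _ *m x]mulmxA; exact: dP_loop_dirs.
- rewrite normrM ger0_norm// ler_pM2l//.
  by rewrite dot_trmul -[d2P S K V W *m _ *m x]mulmxA; exact: d2P_cross.
- by rewrite dot_trmul -[d2P S K V V *m _ *m x]mulmxA; exact: d2P_cross.
Qed.

(** Each term of the source src3 is bounded as a form, by Cauchy-Schwarz weighted
    by P_K; the trace against Sigma then costs a factor tr(Sigma). *)
Lemma third_derivative_le V W : `|state_trace K (src3 S K V W)| <=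
  hessian_lipschitz_const S alpha * (frobenius_norm V ^+ 2 * frobenius_norm W).
Proof.
have vw : 0 <= frobenius_norm V ^+ 2 * frobenius_norm W.
  by apply: mulr_ge0 (frobenius_norm_ge0 _); exact: sqr_ge0.
apply: le_trans (state_trace_le K_stable (src3_le V W)) _.
rewrite mulrAC; apply: ler_wpM2r => //.
have kap0 : 0 <= kap by exact: (kap_ge0 kapE).
have kp := kap_le_p K_stable K_cost kapE.
have XiS := state_trace1_le K_stable K_cost kapE.
rewrite /hessian_lipschitz_const /zeta3 /zeta4 -sE -nuE -pE -nBE -nCE -nRE -gE -z1E -z2E -/h.
move: (state_trace K 1%:M) (state_trace1_ge0 K_stable) XiS => Xi Xi0 XiS.
exact: (third_derivative_constant_ineq s_gt0 nu_gt0 nB_ge0 nC_ge0 p_pos nR_ge0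
  kap0 kp gamma_ge0 (sqrtr_ge0 (r * kap)) (sqr_sqrtr (mulr_ge0 r_ge0 kap0))
  q_ge0 q_sqr z_ge0 z_le1 z_lec zeta2_ge alphaE Xi0 XiS).
Qed.

Lemma second_derivative_le V : 0 < c ->
  state_trace K (src2 S K V V) <= smoothness_const S alpha * frobenius_norm V ^+ 2.
Proof.
move=> c0; apply: le_trans (ler_norm _) _.
apply: le_trans (state_trace_le K_stable (src2_le V V)) _.
have v2 : 0 <= frobenius_norm V ^+ 2 by exact: sqr_ge0.
rewrite -[z3 * _ * _]mulrA -expr2 mulrA mulrAC; apply: ler_wpM2r => //.
have kap0 : 0 <= kap by exact: (kap_ge0 kapE).
have XiS := state_trace1_le K_stable K_cost kapE.
rewrite /smoothness_const -sE -nuE -pE -nBE -nCE -nRE -z1E.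
move: (state_trace K 1%:M) (state_trace1_ge0 K_stable) XiS => Xi Xi0 XiS.
exact: (second_derivative_constant_ineq s_gt0 nu_gt0 c0 p_pos r_ge0 kap0 z_ge0 z_le1
  gamma_ge0 alphaE Xi0 XiS).
Qed.

End source_bounds.
End cost_bounds.

(** * Gradient and Hessian of the cost *)

Section calculus.
Variables (R : realType).

Lemma differentiable_vsum (U W : normedModType R) (I : Type) (s : seq I) (F : I -> U -> W) x :
  (forall i, differentiable (F i) x) -> differentiable (fun u => \sum_(i <- s) F i u) x.
Proof.
move=> h; elim: s => [|i s IH].
  by under eq_fun do rewrite big_nil; exact: differentiable_cst.
by under eq_fun do rewrite big_cons; exact: (differentiableD (h i) IH).
Qed.

Lemma mxdiff_differentiable (U : normedModType R) m n (F : U -> 'M[R]_(m, n)) x :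
  mxdiff F x -> differentiable F x.
Proof.
move=> f; have -> : F = fun u => \sum_i \sum_j F u i j *: delta_mx i j.
  by apply/funext => u; exact: matrix_sum_delta.
apply: differentiable_vsum => i; apply: differentiable_vsum => j.
exact: differentiableZl.
Qed.

Lemma differentiable_mxtrace (U : normedModType R) n (F : U -> 'M[R]_n) x :
  mxdiff F x -> differentiable (fun u => \tr (F u)) x.
Proof. by move=> f; apply: differentiable_bigsum => i; exact: f. Qed.

Lemma derive_mxtrace (U : normedModType R) n (F : U -> 'M[R]_n) x v :
  mxdiff F x -> 'D_v (fun u => \tr (F u)) x = \tr (mxder F x v).
Proof.
move=> f; rewrite /mxtrace.
have -> : (fun u => \sum_i F u i i) = \sum_i (fun u => F u i i).
  by apply/funext => u; rewrite fct_sumE.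
rewrite derive_sum; last by move=> i; apply: diff_derivable; exact: f.
by apply: eq_bigr => i _; rewrite mxE.
Qed.

Lemma derive_along_line (U W : normedModType R) (f : U -> W) x v (t : R) :
  derivable f (x + t *: v) v ->
  is_derive t 1 (fun s : R => f (x + s *: v)) ('D_v f (x + t *: v)).
Proof.
have E : (fun h : R => h^-1 *: (((fun s : R => f (x + s *: v)) \o shift t) (h *: 1) -
    f (x + t *: v))) =
  (fun h : R => h^-1 *: ((f \o shift (x + t *: v)) (h *: v) - f (x + t *: v))).
  apply/funext => h /=; congr (_ *: (f _ - _)).
  by rewrite [h *: 1]mulr1 scalerDl addrCA.
move=> df; apply: DeriveDef; first by rewrite /derivable E.
by rewrite /derive E.
Qed.

Lemma derive_comp_linear (U V W : normedModType R) (f : V -> W) (g : {linear U -> V}) x v :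
  'D_v (f \o g) x = 'D_(g v) f (g x).
Proof.
rewrite /derive.
suff -> : (fun h : R => h^-1 *: ((f \o g \o shift x) (h *: v) - (f \o g) x)) =
  (fun h : R => h^-1 *: ((f \o shift (g x)) (h *: g v) - f (g x))) by [].
by apply/funext => h /=; rewrite linearP.
Qed.

Lemma dot_gradient m n (f : 'M[R]_(m, n) -> R) K V :
  dot (gradient f K) V = 'd f K V.
Proof.
rewrite [V in RHS]matrix_sum_delta linear_sum dotE; apply: eq_bigr => i _.
rewrite linear_sum; apply: eq_bigr => j _.
by rewrite linearZ mxE mulrC.
Qed.

Lemma dot_trmx m n (X Y : 'M[R]_(m, n)) : dot X^T Y^T = dot X Y.
Proof. by rewrite [RHS]dotC /dot trmxK mxtrace_mulC. Qed.

Lemma dot_mxvec m n (X Y : 'M[R]_(m, n)) : dot (mxvec X) (mxvec Y) = dot X Y.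
Proof.
rewrite [LHS]dotE [RHS]dotE big_ord1 pair_bigA /=.
rewrite (reindex (uncurry (@mxvec_index m n))) /=; last first.
  have [g gK Kg] := curry_mxvec_bij m n.
  by exists g => x _; [exact: gK | exact: Kg].
by apply: eq_bigr => -[i j] _; rewrite /= !mxvecE.
Qed.

Lemma vec_mx_differentiable m n (v : 'rV[R]_(m * n)) : differentiable (@vec_mx R m n) v.
Proof. by apply: mxdiff_differentiable; apply: mxdiff_lin => i j; exact: differentiable_coord. Qed.

Lemma near_vec_mx m n (D : set 'M[R]_(m, n)) (X : 'M[R]_(m, n)) :
  (\forall Y \near X, D Y) -> \forall v \near mxvec X, D (vec_mx v).
Proof.
move=> XD; have {}XD : nbhs (vec_mx (mxvec X)) D by rewrite mxvecK.
exact: (differentiable_continuous (vec_mx_differentiable (mxvec X)) XD).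
Qed.

Lemma near_line m n (D : set 'M[R]_(m, n)) (X V : 'M[R]_(m, n)) :
  (\forall Y \near X, D Y) -> \forall t \near (0 : R), D (X + t *: V).
Proof.
have line_cont : {for (0 : R), continuous (fun t : R => X + t *: V)}.
  by apply: cvgD; [exact: cvg_cst | exact: scalel_continuous].
by move=> XD; apply: line_cont; rewrite scale0r addr0.
Qed.

Lemma derive_local_min m n (f : 'M[R]_(m, n) -> R) (D : set 'M[R]_(m, n))
    (X V : 'M[R]_(m, n)) :
  (\forall Y \near X, D Y /\ f X <= f Y) -> (forall Y, D Y -> differentiable f Y) ->
  'D_V f X = 0.
Proof.
move=> nD df; have /nbhs_ballP[e /= e0 he] := near_line V nD.
have inD (t : R) : t \in `]- e, e[ -> D (X + t *: V) /\ f X <= f (X + t *: V).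
  by rewrite in_itv /= => te; apply: he; rewrite /ball /= sub0r normrN ltr_norml.
have lineX : X + 0 *: V = X by rewrite scale0r addr0.
have der (t : R) : t \in `]- e, e[ ->
    is_derive t (1 : R) (fun t : R => f (X + t *: V)) ('D_V f (X + t *: V)).
  by move=> /inD[Dt _]; apply: derive_along_line; apply: diff_derivable; exact: df.
have e_in : 0 \in `]- e, e[ by rewrite in_itv /= oppr_lt0 e0.
have min0 : is_derive (0 : R) (1 : R) (fun t : R => f (X + t *: V)) (0 : R).
  apply: (@derive1_at_min _ _ (- e) e _ _ _ e_in).
  - by apply: (@le_trans _ _ 0); [rewrite oppr_le0 ltW | exact: ltW].
  - by move=> t /der[].
  - by move=> t /inD[_]; rewrite lineX.
have := @derive_val _ _ _ _ _ _ _ (der 0 e_in).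
by rewrite (@derive_val _ _ _ _ _ _ _ min0) lineX.
Qed.

(** Mean value theorem for f minus the quadratic a t + b t^2 / 2. *)
Lemma increment_le (f df : R -> R) (a b s : R) : 0 <= s ->
  (forall t, 0 <= t <= s -> is_derive t (1 : R) f (df t)) ->
  (forall t, 0 <= t <= s -> df t <= a + b * t) ->
  f s - f 0 <= a * s + b / 2 * s ^+ 2.
Proof.
move=> s0 der hdf.
pose g (t : R) : R := f t - (a * t + b / 2 * t ^+ 2).
have dg (t : R) : 0 <= t <= s -> is_derive t (1 : R) g (df t - (a + b * t)).
  move=> /der dt; have dX := @is_deriveX R R id 2 t 1 1 (is_derive_id t 1).
  have dp : is_derive t (1 : R) (fun t : R => a * t + b / 2 * t ^+ 2) (a + b * t).
    have h := is_deriveD (is_deriveZ a (is_derive_id t (1 : R))) (is_deriveZ (b / 2) dX).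
    by apply: (is_derive_eq h); rewrite /GRing.scale /=; field.
  exact: (is_deriveB dt dp).
have [||t] := @MVT_segment R g (fun t => df t - (a + b * t)) 0 s s0.
- by move=> t; rewrite in_itv /= => /andP[t0 ts]; apply: dg; rewrite !ltW.
- apply: derivable_within_continuous => t; rewrite in_itv /= => /dg dt.
  exact: ex_derive.
rewrite in_itv /= => tin; rewrite subr0 => e.
have : g s - g 0 <= 0 by rewrite e mulr_le0_ge0// subr_le0 hdf.
by rewrite /g mulr0 expr0n mulr0 /=; lra.
Qed.

End calculus.

Section stabilizing_gains.
Variables (R : realType) (disp : measure_display) (Omega : measurableType disp).
Variables (P : probability Omega R) (n m d : nat) (S : sof_lqr P n m d).

Lemma mxdiff_mxpow (U : normedModType R) k (F : U -> 'M[R]_k) x t :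
  mxdiff F x -> mxdiff (fun u => mxpow (F u) t) x.
Proof. by move=> f; elim: t => [|t IH]; [exact: mxdiff_cst | exact: mxdiffM]. Qed.

(** Stability of a gain is witnessed by one small power of its closed loop. *)
Lemma stabilizing_open K : stabilizing S K -> \forall K' \near K, stabilizing S K'.
Proof.
move=> sK; have [c c0 [r /andP[r0 r1] h]] := mxpow_geometric sK.
pose q : R := n.+1%:R^-1.
have q0 : 0 < q by rewrite invr_gt0.
have [t ht] : exists t, c * r ^+ t < q.
  have : (fun t => c * r ^+ t) @ \oo --> (0 : R).
    by apply: cvg_geometric; rewrite ger0_norm.
  move=> /cvgrPdist_lt/(_ _ q0)[N _ /(_ N (leqnn N))] /=.
  by rewrite sub0r normrN => hN; exists N; exact: le_lt_trans (ler_norm _) hN.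
have near_entry (ij : 'I_n * 'I_n) :
    \forall K' \near K, `|mxpow (closed_loop S K') t ij.1 ij.2| < q.
  have cont := differentiable_continuous
    (mxdiff_mxpow t (mxdiff_closed_loop S K) ij.1 ij.2).
  have cn : {for K, continuous (fun K' => `|mxpow (closed_loop S K') t ij.1 ij.2|)}.
    by apply: continuous_comp; [exact: cont | exact: norm_continuous].
  apply: (cn [set y | y < q]); apply: open_nbhs_nbhs; split; first exact: open_lt.
  exact: le_lt_trans (h t _ _) ht.
have near_entries := filter_forall (nbhs_filter K) near_entry.
apply: filterS near_entries => K' hK'; apply: (@small_power_stable _ _ _ t q).
  by move=> i j; apply: ltW; exact: (hK' (i, j)).
by rewrite /q ltr_pdivrMr ?mul1r ?ltr_nat.
Qed.

End stabilizing_gains.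

Section cost_differentials.
Variables (R : realType) (disp : measure_display) (Omega : measurableType disp).
Variables (P : probability Omega R) (n m d : nat) (S : sof_lqr P n m d).
Hypothesis x_init_L2 : forall i, (x_init S i : Omega -> R) \in Lfun P 2%:E.
Hypotheses (Q_posdef : posdefmx (Qmx S)) (R_posdef : posdefmx (Rmx S)).
Local Notation X0 := (second_moment S).
Implicit Types K V W : 'M[R]_(m, d).

Lemma symB (X Y : 'M[R]_n) : sym (X - Y) = sym X - sym Y.
Proof. by rewrite symD -scaleN1r symZ scaleN1r. Qed.

Definition cost1 K V : R := state_trace S K (src1 S K V).
Definition cost2 K V W : R := state_trace S K (src2 S K V W).
Definition cost3 K V W : R := state_trace S K (src3 S K V W).

Lemma cost_near K : stabilizing S K ->
  \forall K' \near K, \tr (value_matrix S K' *m X0) = cost S K'.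
Proof.
by move=> /stabilizing_open; apply: filterS => K' sK'; rewrite costE.
Qed.

Lemma mxdiff_mulX0 (F : 'M[R]_(m, d) -> 'M[R]_n) K : mxdiff F K ->
  differentiable (fun K => \tr (F K *m X0)) K.
Proof. by move=> f; apply: differentiable_mxtrace; exact: mxdiffMr. Qed.

Lemma derive_mulX0 (F : 'M[R]_(m, d) -> 'M[R]_n) K W : mxdiff F K ->
  'D_W (fun K => \tr (F K *m X0)) K = \tr (mxder F K W *m X0).
Proof. by move=> f; rewrite derive_mxtrace ?mxderMr//; exact: mxdiffMr. Qed.

Lemma differentiable_cost K : stabilizing S K -> differentiable (cost S) K.
Proof.
move=> sK; apply: near_eq_differentiable (cost_near sK) _.
by apply: mxdiff_mulX0; exact: mxdiff_value_matrix.
Qed.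

Lemma derive_cost K V : stabilizing S K -> 'D_V (cost S) K = cost1 K V.
Proof.
move=> sK; rewrite -(near_eq_derive V (cost_near sK)) derive_mulX0; last exact: mxdiff_value_matrix.
by rewrite mxder_value_matrix.
Qed.

Lemma differentiable_cost1 K V : stabilizing S K -> differentiable (fun K => cost1 K V) K.
Proof. by move=> sK; apply: mxdiff_mulX0; exact: mxdiff_dP. Qed.

Lemma derive_cost1 K V W : stabilizing S K -> 'D_W (fun K => cost1 K V) K = cost2 K V W.
Proof. by move=> sK; rewrite derive_mulX0 ?mxder_dP//; exact: mxdiff_dP. Qed.

Lemma differentiable_cost2 K V W : stabilizing S K -> differentiable (fun K => cost2 K V W) K.
Proof. by move=> sK; apply: mxdiff_mulX0; exact: mxdiff_d2P. Qed.

Lemma derive_cost2 K V W : stabilizing S K -> 'D_W (fun K => cost2 K V V) K = cost3 K V W.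
Proof. by move=> sK; rewrite derive_mulX0 ?mxder_d2P//; exact: mxdiff_d2P. Qed.

Lemma src2C K V W : stabilizing S K -> src2 S K V W = src2 S K W V.
Proof.
move=> sK; have symT (Y Z1 Z2 : 'M[R]_n) : sym (Y - Z1 - Z2) = sym (Y^T - Z2 - Z1).
  by rewrite !symB -(trmx_sym Y) /sym [(Y + _)^T]linearD /= trmxK addrAC.
have e : ((V *m Cmx S)^T *m (Rmx S *m (W *m Cmx S)) +
    (loop_dir S V)^T *m (value_matrix S K *m loop_dir S W))^T =
    (W *m Cmx S)^T *m (Rmx S *m (V *m Cmx S)) +
    (loop_dir S W)^T *m (value_matrix S K *m loop_dir S V).
  move: (W *m Cmx S) (V *m Cmx S) (loop_dir S V) (loop_dir S W) => a b a' b'.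
  rewrite linearD /= !trmx_mul !trmxK R_posdef.1.
  by rewrite (trmx_value_matrix Q_posdef R_posdef sK) !mulmxA.
exact: (etrans (symT _ _ _) (congr1 (fun Y => sym (Y - _ - _)) e)).
Qed.

Lemma cost2C K V W : stabilizing S K -> cost2 K V W = cost2 K W V.
Proof. by move=> sK; rewrite /cost2 src2C. Qed.

Lemma cost1_diff K V : stabilizing S K -> cost1 K V = 'd (cost S) K V.
Proof. by move=> sK; rewrite -derive_cost// deriveE//; exact: differentiable_cost. Qed.

Lemma cost2_diff K V W : stabilizing S K -> cost2 K V W = 'd (fun K => cost1 K V) K W.
Proof. by move=> sK; rewrite -derive_cost1// deriveE//; exact: differentiable_cost1. Qed.

Lemma dot_gradient_cost K V : stabilizing S K -> dot (gradient (cost S) K) V = cost1 K V.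
Proof. by move=> sK; rewrite dot_gradient cost1_diff. Qed.

Let vec := @vec_mx R m d.

Let vec_dir (j : 'I_(m * d)) : 'M[R]_(m, d) := vec (delta_mx 0 j).

Let vec_gradient (v : 'rV[R]_(m * d)) : 'rV[R]_(m * d) := \row_j cost1 (vec v) (vec_dir j).

Lemma gradient_vec_near K : stabilizing S K ->
  \forall v \near mxvec K, vec_gradient v = gradient (fun v => cost S (vec_mx v)) v.
Proof.
move=> sK; have vK : vec (mxvec K) = K by exact: mxvecK.
have near_stab := near_vec_mx (stabilizing_open sK).
apply: filterS near_stab => v sv; apply/rowP => j; rewrite !mxE.
rewrite -derive_cost// -deriveE; last first.
  apply: (@differentiable_comp _ _ _ _ vec (cost S)); first exact: vec_mx_differentiable.
  exact: differentiable_cost.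
by rewrite -(derive_comp_linear (cost S) vec).
Qed.

(** Near mxvec K the gradient has the entries cost1 along the basis matrices, and
    their derivatives are the values of cost2. *)
Lemma mul_vec_hessian K (w : 'rV[R]_(m * d)) : stabilizing S K ->
  w *m vec_hessian (cost S) K = \row_j cost2 K (vec_dir j) (vec w).
Proof.
move=> sK; have vK : vec (mxvec K) = K by exact: mxvecK.
have gn := gradient_vec_near sK.
have dG : mxdiff vec_gradient (mxvec K).
  move=> i j; under eq_fun do rewrite mxE.
  apply: (@differentiable_comp _ _ _ _ vec (fun K => cost1 K (vec_dir j))).
    exact: vec_mx_differentiable.
  by rewrite vK; exact: differentiable_cost1.
have dG' := mxdiff_differentiable dG.
rewrite /vec_hessian /hessian -derivemxE; last exact: near_eq_differentiable gn dG'.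
rewrite -(near_eq_derive w gn) derive_mx; last exact: diff_derivable.
apply/matrixP => i j; rewrite [LHS]mxE [RHS]mxE.
have -> : (fun v => vec_gradient v i j) = (fun K => cost1 K (vec_dir j)) \o @vec_mx R m d.
  by apply/funext => v; rewrite [LHS]mxE.
transitivity ('D_(vec w) (fun K => cost1 K (vec_dir j)) (vec (mxvec K))).
  exact: derive_comp_linear.
by rewrite vK; exact: derive_cost1.
Qed.

Lemma trmx_vec_hessian K : stabilizing S K ->
  (vec_hessian (cost S) K)^T = vec_hessian (cost S) K.
Proof.
move=> sK; have E i j : vec_hessian (cost S) K i j = cost2 K (vec_dir j) (vec_dir i).
  have := mul_vec_hessian (delta_mx 0 i) sK; rewrite -rowE => /rowP/(_ j).
  by rewrite !mxE.
by apply/matrixP => i j; rewrite mxE !E cost2C.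
Qed.

Lemma cost2_coordinates K V (w : 'rV[R]_(m * d)) : stabilizing S K ->
  cost2 K V (vec w) = \sum_j w 0 j * cost2 K V (vec_dir j).
Proof.
move=> sK; rewrite cost2_diff// {1}(row_sum_delta w) /vec 2!linear_sum.
by apply: eq_bigr => j _; rewrite 2!linearZ /= -cost2_diff.
Qed.

Lemma vec_hessian_form K V : stabilizing S K ->
  dot (mxvec V)^T (vec_hessian (cost S) K *m (mxvec V)^T) = cost2 K V V.
Proof.
move=> sK; have vV : vec (mxvec V) = V by exact: mxvecK.
have -> : cost2 K V V = cost2 K V (vec (mxvec V)) by rewrite vV.
have e : vec_hessian (cost S) K *m (mxvec V)^T = (\row_j cost2 K (vec_dir j) V)^T.
  by rewrite -[V in RHS]vV -mul_vec_hessian// trmx_mul trmx_vec_hessian.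
rewrite cost2_coordinates// e; move: (mxvec V) => w.
rewrite dotE; apply: eq_bigr => j _.
by rewrite big_ord1 !mxE cost2C.
Qed.

Lemma lambda_min_hessian_le K V : stabilizing S K ->
  lambda_min (vec_hessian (cost S) K) * dot V V <= cost2 K V V.
Proof.
move=> sK; rewrite -vec_hessian_form//.
have := lambda_min_rayleigh (mxvec V)^T (trmx_vec_hessian sK).
have -> // : dot (mxvec V)^T (mxvec V)^T = dot V V.
by rewrite dot_trmx dot_mxvec.
Qed.

(** A local minimum in the open set of stabilizing gains is a critical point:
    along each line the cost has a local minimum at 0. *)
Lemma cost1_local_min K V : stabilizing S K ->
  local_min_in (stabilizing S) (cost S) K -> cost1 K V = 0.
Proof.
move=> sK Kmin; rewrite -derive_cost//.
apply: (@derive_local_min _ _ _ _ (stabilizing S)); last by move=> K' sK'; exact: differentiable_cost.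
by apply: filterS2 (stabilizing_open sK) Kmin => K' sK' /(_ sK').
Qed.

End cost_differentials.

(** * One step of gradient descent *)

Section gradient_descent_recursion.
Variable R : realType.

(** With u = r0 / (r0 + T) the factor 1 - q (1 - u) is (r0 + T - q T) / (r0 + T),
    and (r0 + T - q T) (r0 + T + q T) <= (r0 + T)^2. So the closed form
    rbar r0 / (r0 + T) survives a step when T is multiplied by 1 + q. *)
Lemma nesterov_step (q rbar r0 T r r' : R) :
  0 <= q -> q <= 1 -> 0 < rbar -> 0 <= r0 -> 0 < T -> 0 <= r ->
  r <= rbar * r0 / (r0 + T) -> r' <= (1 - q + q * r / rbar) * r ->
  r' <= rbar * r0 / (r0 + (1 + q) * T).
Proof.
move=> q0 q1 rb0 r00 T0 r0' rle r'le.
have D0 : 0 < r0 + T by lra.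
have D1 : 0 < r0 + (1 + q) * T by nra.
pose u := r0 / (r0 + T).
have u0 : 0 <= u by rewrite /u divr_ge0// ltW.
have xE : rbar * r0 / (r0 + T) = rbar * u by rewrite /u mulrA.
rewrite xE in rle.
have a1 : 1 - q + q * r / rbar <= 1 - q + q * u.
  rewrite lerD2l -mulrA ler_wpM2l// ler_pdivrMr// mulrC//.
have a0 : 0 <= 1 - q + q * r / rbar.
  by rewrite addr_ge0 ?subr_ge0// divr_ge0 ?mulr_ge0// ltW.
apply: le_trans r'le _; apply: (@le_trans _ _ ((1 - q + q * u) * (rbar * u))).
  exact: ler_pM.
have e1 : (1 - q + q * u) * (rbar * u) = rbar * r0 * ((r0 + T - q * T) / (r0 + T) ^+ 2).
  by rewrite /u; field; rewrite gt_eqF.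
rewrite e1 -[leRHS]mulrA; rewrite -[leLHS]mulrA ler_wpM2l ?(ltW rb0)// ler_wpM2l//.
rewrite ler_pdivrMr ?exprn_gt0// [leRHS]mulrC ler_pdivlMr//.
have := sqr_ge0 (q * T); nra.
Qed.

Lemma hessian_segment_arith (x y v l M r t : R) :
  - y - - x <= M * (v * r) * t -> l * v <= x -> (l - M * r * t) * v <= y.
Proof. by move=> h1 h2; lra. Qed.

Lemma residual_arith (eta l M r t v x : R) : 0 <= eta -> (l - M * r * t) * v <= x ->
  v - eta * x <= (1 - eta * l + eta * M * r * t) * v.
Proof. by move=> eta0 /(ler_wpM2l eta0); lra. Qed.

End gradient_descent_recursion.

Section local_convergence.
Variables (R : realType) (disp : measure_display) (Omega : measurableType disp).
Variables (P : probability Omega R) (n m d : nat) (S : sof_lqr P n m d).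
Hypothesis x_init_L2 : forall i, (x_init S i : Omega -> R) \in Lfun P 2%:E.
Hypotheses (Q_posdef : posdefmx (Qmx S)) (R_posdef : posdefmx (Rmx S)).
Variables (L M alpha eta l : R) (K E : 'M[R]_(m, d)).
Opaque cost cost1 cost2 cost3 state_trace frobenius_norm dot gradient.
Hypothesis smooth : forall K' V, sublevel S alpha K' ->
  cost2 S K' V V <= L * frobenius_norm V ^+ 2.
Hypothesis hessian_lipschitz : forall K' V W, sublevel S alpha K' ->
  `|cost3 S K' V W| <= M * (frobenius_norm V ^+ 2 * frobenius_norm W).
Hypothesis K_critical : forall V, cost1 S K V = 0.
Hypothesis K_hessian : forall V, l * frobenius_norm V ^+ 2 <= cost2 S K V V.
Hypotheses (eta_ge0 : 0 <= eta) (etaL : eta * L <= 1).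
Hypothesis segment : forall t : R, 0 <= t <= 1 -> sublevel S alpha (K + t *: E).

Let r := frobenius_norm E.
Let r_ge0 : 0 <= r := frobenius_norm_ge0 E.

(** Along the segment the Hessian loses at most M per unit of length. *)
Lemma cost2_segment_ge (t : R) V : 0 <= t <= 1 ->
  (l - M * r * t) * frobenius_norm V ^+ 2 <= cost2 S (K + t *: E) V V.
Proof.
move=> /andP[t0 t1]; have seg (s : R) : 0 <= s <= t -> sublevel S alpha (K + s *: E).
  by move=> /andP[s0 st]; apply: segment; rewrite s0 (le_trans st).
have := @increment_le R (fun s => - cost2 S (K + s *: E) V V)
  (fun s => - cost3 S (K + s *: E) V E) (M * (frobenius_norm V ^+ 2 * r)) 0 t t0.
rewrite scale0r addr0 mul0r mul0r addr0 => h.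
suff H : - cost2 S (K + t *: E) V V - - cost2 S K V V <= M * (frobenius_norm V ^+ 2 * r) * t.
  exact: hessian_segment_arith H (K_hessian V).
apply: h => s /seg ss.
  apply: is_deriveN; rewrite -(derive_cost2 Q_posdef R_posdef _ _ ss.1).
  by apply: derive_along_line; apply: diff_derivable; exact: differentiable_cost2 ss.1.
rewrite mul0r addr0; apply: le_trans (hessian_lipschitz V E ss).
by rewrite -normrN ler_norm.
Qed.

(** The form of I - eta H, where H is the Hessian at K + t E. *)
Let B (t : R) V W := dot V W - eta * cost2 S (K + t *: E) V W.

Lemma residual_ge0 t V : 0 <= t <= 1 -> 0 <= B t V V.
Proof.
move=> /segment st; rewrite /B subr_ge0 -sqr_frobenius_norm.
apply: le_trans (ler_wpM2l eta_ge0 (smooth V st)) _.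
by rewrite mulrA ler_piMl ?sqr_ge0.
Qed.

Lemma residual_le t V : 0 <= t <= 1 ->
  B t V V <= (1 - eta * l + eta * M * r * t) * frobenius_norm V ^+ 2.
Proof.
move=> t01; rewrite /B -sqr_frobenius_norm.
exact: residual_arith eta_ge0 (cost2_segment_ge V t01).
Qed.

Lemma residual_schwarz t V W : 0 <= t <= 1 -> B t V W ^+ 2 <= B t V V * B t W W.
Proof.
move=> t01; apply: discriminant_le => [a|]; last exact: residual_ge0.
have st := (segment t01).1.
suff <- : B t (V + a *: W) (V + a *: W) = B t V V + 2 * B t V W * a + B t W W * a ^+ 2.
  exact: residual_ge0.
have linr X Y Z b : cost2 S (K + t *: E) X (Y + b *: Z) =
    cost2 S (K + t *: E) X Y + b * cost2 S (K + t *: E) X Z.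
  by rewrite !(cost2_diff Q_posdef R_posdef _ _ st) linearD linearZ.
have symm X Y := cost2C Q_posdef R_posdef X Y st.
have e : cost2 S (K + t *: E) (V + a *: W) (V + a *: W) = cost2 S (K + t *: E) V V +
   2 * a * cost2 S (K + t *: E) V W + a ^+ 2 * cost2 S (K + t *: E) W W.
  rewrite linr (symm (V + a *: W) V) linr (symm (V + a *: W) W) linr (symm W V).
  move: (cost2 _ _ V V) (cost2 _ _ V W) (cost2 _ _ W W) => x y z; ring.
rewrite /B e !dotDl !dotDr !dotZl !dotZr (dotC W V).
by move: (cost2 _ _ V V) (cost2 _ _ V W) (cost2 _ _ W W) => x y z; ring.
Qed.

Let contraction := 1 - eta * l + eta * M * r / 2.

(** The gradient step moves K + t E with derivative (I - eta H) E. The form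
    I - eta H is nonnegative because eta L <= 1, and at most
    1 - eta l + eta M r t, so Cauchy-Schwarz bounds its values on the pair formed
    by E and the new error V; integration over t in [0, 1] gives the factor. *)
Lemma descent_step :
  frobenius_norm (E - eta *: gradient (cost S) (K + E)) <= contraction * r.
Proof.
set V := E - _; set v := frobenius_norm V.
have v0 : 0 <= v := frobenius_norm_ge0 V.
have [E0|En0] := eqVneq E 0.
  have -> : v = 0.
    apply/eqP; rewrite frobenius_norm_eq0 /V -dot_eq0 E0 sub0r addr0.
    rewrite dotNl dotNr opprK dotZl dot_gradient_cost// ?K_critical ?mulr0//.
    by have := segment (t := 0); rewrite lexx ler01 scale0r addr0 => /(_ isT)[].
  by rewrite /r E0; have /eqP -> : frobenius_norm (0 : 'M[R]_(m, d)) == 0;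
    rewrite ?frobenius_norm_eq0 ?mulr0.
have r0 : 0 < r by rewrite lt_def r_ge0 frobenius_norm_eq0 En0.
have c0 t : 0 <= t <= 1 -> 0 <= 1 - eta * l + eta * M * r * t.
  move=> t01; rewrite -(pmulr_lge0 _ (_ : 0 < r ^+ 2)) ?exprn_gt0//.
  exact: le_trans (residual_ge0 E t01) (residual_le E t01).
have Ble t : 0 <= t <= 1 -> B t V E <= (1 - eta * l) * (v * r) + eta * M * r * (v * r) * t.
  move=> t01; apply: le_trans (ler_norm _) _.
  have -> : (1 - eta * l) * (v * r) + eta * M * r * (v * r) * t =
    ((1 - eta * l + eta * M * r * t) * v) * r by ring.
  rewrite -[leRHS]ger0_norm ?mulr_ge0 ?c0// -ler_sqr ?nnegrE ?normr_ge0//.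
  rewrite !real_normK ?num_real//; apply: le_trans (residual_schwarz V E t01) _.
  have -> : ((1 - eta * l + eta * M * r * t) * v * r) ^+ 2 =
    ((1 - eta * l + eta * M * r * t) * v ^+ 2) *
    ((1 - eta * l + eta * M * r * t) * r ^+ 2) by ring.
  by apply: ler_pM; rewrite ?residual_ge0 ?residual_le.
have := @increment_le R (fun t => dot V E * t - eta * cost1 S (K + t *: E) V)
  (fun t => B t V E) ((1 - eta * l) * (v * r)) (eta * M * r * (v * r)) 1 ler01 _ Ble.
rewrite scale0r addr0 K_critical scale1r !mulr0 mulr1 subr0 subr0 expr1n !mulr1 => h.
have s1 : stabilizing S (K + E).
  by have := segment (t := 1); rewrite lexx ler01 scale1r => /(_ isT)[].
have vv : dot V E - eta * cost1 S (K + E) V = v ^+ 2.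
  rewrite -dot_gradient_cost// [dot (gradient _ _) _]dotC -dotZr -dotBr.
  by rewrite -/V sqr_frobenius_norm.
have {}h : v ^+ 2 <= v * (contraction * r).
  rewrite -vv; apply: le_trans (h _) _; last first.
    by rewrite /contraction le_eqVlt; apply/orP; left; apply/eqP; field.
  move=> t t01; have st := (segment t01).1.
  have d1 : is_derive t (1 : R) (fun t : R => dot V E * t) (dot V E).
    have := is_deriveZ (dot V E) (is_derive_id t (1 : R)).
    by rewrite /GRing.scale /= mulr1.
  apply: is_deriveB; apply: is_deriveZ.
  rewrite -(derive_cost1 Q_posdef R_posdef _ _ st).
  by apply: derive_along_line; apply: diff_derivable; exact: differentiable_cost1.
have [v00|vn0] := eqVneq v 0.
  rewrite v00 mulr_ge0// /contraction.
  have : 0 <= (2 : R)^-1 <= 1 by lra.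
  exact: c0.
have vp : 0 < v by rewrite lt_def vn0.
by rewrite -(ler_pM2l vp) -expr2.
Qed.

End local_convergence.

(** * Linear convergence *)

Section linear_rate.
Variables (R : realType) (disp : measure_display) (Omega : measurableType disp).
Variables (P : probability Omega R) (n m d : nat) (S : sof_lqr P n m d).
Hypothesis x_init_L2 : forall i, (x_init S i : Omega -> R) \in Lfun P 2%:E.
Hypotheses (Q_posdef : posdefmx (Qmx S)) (R_posdef : posdefmx (Rmx S)).
Variables (L M alpha eta l : R) (K K0 : 'M[R]_(m, d)).
Hypothesis smooth : forall K' V, sublevel S alpha K' ->
  cost2 S K' V V <= L * frobenius_norm V ^+ 2.
Hypothesis hessian_lipschitz : forall K' V W, sublevel S alpha K' ->
  `|cost3 S K' V W| <= M * (frobenius_norm V ^+ 2 * frobenius_norm W).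
Hypothesis K_critical : forall V, cost1 S K V = 0.
Hypothesis K_hessian : forall V, l * frobenius_norm V ^+ 2 <= cost2 S K V V.
Hypotheses (l_gt0 : 0 < l) (M_gt0 : 0 < M).
Hypotheses (eta_ge0 : 0 <= eta) (etaL : eta * L <= 1) (etal : eta * l <= 1).
Let rbar := 2 * l / M.
Let r0 := frobenius_norm (K0 - K).
Hypothesis r0_lt : r0 < rbar.
Hypothesis ball_sub : forall E, frobenius_norm E <= r0 -> sublevel S alpha (K + E).

Let r0_ge0 : 0 <= r0. Proof. exact: frobenius_norm_ge0. Qed.
Let T i := (1 + eta * l) ^+ i * (rbar - r0).

Let q_ge0 : 0 <= eta * l. Proof. by rewrite mulr_ge0// ltW. Qed.

Let T_ge i : rbar - r0 <= T i.
Proof.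
by apply: ler_peMl; [rewrite subr_ge0 ltW | rewrite exprn_ege1// lerDl].
Qed.

Let T_gt0 i : 0 < T i.
Proof. by apply: lt_le_trans (T_ge i); rewrite subr_gt0. Qed.

Let rbar_gt0 : 0 < rbar. Proof. exact: le_lt_trans r0_lt. Qed.

(** The iterates stay in the ball of radius r0 because T increases, so the step
    estimate applies along the segment from K to each of them. *)
Lemma descent_rate i :
  frobenius_norm (gradient_descent (cost S) eta K0 i - K) <= rbar * r0 / (r0 + T i).
Proof.
elim: i => [|i IH].
  by rewrite /T expr0 mul1r [r0 + _]addrC subrK mulrAC mulfV ?mul1r// gt_eqF.
have -> : T i.+1 = (1 + eta * l) * T i by rewrite /T exprS mulrA.
set Ki := gradient_descent _ _ _ i in IH *; set E := Ki - K in IH *.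
have KE : Ki = K + E by rewrite /E addrC subrK.
have -> : gradient_descent (cost S) eta K0 i.+1 - K =
    E - eta *: gradient (cost S) (K + E).
  by rewrite /gradient_descent iterS -/(gradient_descent _ _ _ i) -/Ki -KE /E addrAC.
have Er0 : frobenius_norm E <= r0.
  apply: le_trans IH _; rewrite ler_pdivrMr; last by rewrite ltr_wpDl.
  rewrite mulrC ler_wpM2l//; have := T_ge i; lra.
have segment (t : R) : 0 <= t <= 1 -> sublevel S alpha (K + t *: E).
  move=> /andP[t0 t1]; apply: ball_sub; rewrite frobenius_normZ ger0_norm//.
  by apply: le_trans Er0; rewrite ler_piMl ?frobenius_norm_ge0.
apply: (nesterov_step q_ge0 etal rbar_gt0 r0_ge0 (T_gt0 i) (frobenius_norm_ge0 E) IH).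
have := descent_step x_init_L2 Q_posdef R_posdef smooth hessian_lipschitz K_critical
  K_hessian eta_ge0 etaL segment.
have -> // : eta * l * frobenius_norm E / rbar = eta * M * frobenius_norm E / 2.
by rewrite /rbar; field; rewrite !gt_eqF.
Qed.

Lemma descent_linear_rate i :
  frobenius_norm (gradient_descent (cost S) eta K0 i - K) <=
  rbar * r0 / (rbar - r0) * (1 / (1 + eta * l)) ^+ i.
Proof.
apply: le_trans (descent_rate i) _.
have q1 : 0 < 1 + eta * l by rewrite ltr_wpDr.
have d0 : 0 < rbar - r0 by rewrite subr_gt0.
have -> : rbar * r0 / (rbar - r0) * (1 / (1 + eta * l)) ^+ i = rbar * r0 / T i.
  have frac (a b p : R) : a / b * p^-1 = a / (p * b).
    by rewrite invfM mulrA -!(mulrAC _ _ b^-1).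
  by rewrite div1r exprVn frac.
have D0 : 0 < r0 + T i by rewrite ltr_wpDl.
apply: ler_wpM2l; first exact: (mulr_ge0 (ltW rbar_gt0) r0_ge0).
by rewrite lef_pV2 ?posrE// lerDr.
Qed.

End linear_rate.

Section distances.
Variables (R : realType) (disp : measure_display) (Omega : measurableType disp).
Variables (P : probability Omega R) (n m d : nat) (S : sof_lqr P n m d).

Lemma near_sublevel_sub (a b : R) (K E : 'M[R]_(m, d)) : sublevel S b K ->
  ((frobenius_norm E)%:E < sublevel_dist S b a)%E -> sublevel S a (K + E).
Proof.
move=> Kb ltE; have : strict_sublevel S a (K + E); last by case=> sK /ltW.
apply: contrapT => nK; move: ltE; rewrite ltNge => /negP; apply.
apply: (@le_trans _ _ (spectral_norm (K - (K + E)))%:E).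
  by apply: ereal_inf_lbound; exists K => //; exists (K + E).
rewrite lee_fin; apply: le_trans (spectral_norm_le_frobenius _) _.
by rewrite opprD addNKr -scaleN1r frobenius_normZ normrN1 mul1r.
Qed.

Lemma mx_neq0_dims a b (X : 'M[R]_(a, b)) : X != 0 -> (0 < a)%N /\ (0 < b)%N.
Proof.
case: a X => [|a] X; first by rewrite (flatmx0 X) eqxx.
by case: b X => [|b] X; first by rewrite (thinmx0 X) eqxx.
Qed.

Lemma spectral_norm_neq0 a b (X : 'M[R]_(a, b)) : spectral_norm X != 0 -> X != 0.
Proof.
apply: contraNneq => ->; rewrite eq_le spectral_norm_ge0 andbT.
by apply: spectral_norm_le => // x; rewrite mul0mx dot0l expr0n mul0r.
Qed.

End distances.

Theorem theorem2 (R : realType) (disp : measure_display)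
    (Omega : measurableType disp) (P : probability Omega R) (n m d : nat)
    (S : sof_lqr P n m d)
    (C_full_row_rank : row_free (Cmx S))
    (Q_posdef : posdefmx (Qmx S))
    (R_posdef : posdefmx (Rmx S))
    (x_init_L2 : forall i, (x_init S i : Omega -> R) \in Lfun P 2%:E)
    (mu_gt0 : 0 < mu S)
    (B_neq0 : Bmx S != 0)
    (Kstar : 'M[R]_(m, d))
    (Kstar_min : global_min_in (stabilizing S) (cost S) Kstar)
    (alpha beta : R)
    (le_beta : cost S Kstar <= beta)
    (lt_beta_alpha : beta < alpha)
    (Kdd : 'M[R]_(m, d))
    (Kdd_sub : sublevel S beta Kdd)
    (Kdd_min : local_min_in (stabilizing S) (cost S) Kdd)
    (K0 : 'M[R]_(m, d)) (eta : R) :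
  let omega := sublevel_dist S beta alpha in
  let l := lambda_min (vec_hessian (cost S) Kdd) in
  let rbar := 2 * l / hessian_lipschitz_const S alpha in
  let r0 := frobenius_norm (K0 - Kdd) in
  0 < l ->
  r0 < rbar ->
  ((rbar * r0 / (rbar - r0))%:E <= omega)%E ->
  0 < eta ->
  eta <= 1 / smoothness_const S alpha ->
  forall i : nat,
    frobenius_norm (gradient_descent (cost S) eta K0 i - Kdd)
      <= rbar * r0 / (rbar - r0) * (1 / (1 + eta * l)) ^+ i.
Proof.
move=> omega l rbar r0 l_gt0 r0_lt le_omega eta_gt0 eta_le.
have [n_gt0 m_gt0] := mx_neq0_dims B_neq0.
have L_gt0 : 0 < smoothness_const S alpha.
  by have := lt_le_trans eta_gt0 eta_le; rewrite div1r invr_gt0.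
have C_neq0 : Cmx S != 0.
  apply: spectral_norm_neq0; apply: contraTneq L_gt0 => C0.
  by rewrite /smoothness_const C0 expr0n mulr0 !mul0r ltxx.
have [d_gt0 _] := mx_neq0_dims C_neq0.
have r0_ge0 : 0 <= r0 by exact: frobenius_norm_ge0.
have rbar_gt0 : 0 < rbar by exact: le_lt_trans r0_lt.
have M_gt0 : 0 < hessian_lipschitz_const S alpha.
  by move: rbar_gt0; rewrite /rbar pmulr_rgt0; [rewrite invr_gt0 | exact: mulr_gt0].
have Kdd_stable := Kdd_sub.1.
have kapE K : mu S * (\tr (control_cost S K *m second_moment S) / mu S) =
    \tr (control_cost S K *m second_moment S) by rewrite mulrC divfK// gt_eqF.
have smooth K V (sK : sublevel S alpha K) :
    cost2 S K V V <= smoothness_const S alpha * frobenius_norm V ^+ 2.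
  apply: (second_derivative_le x_init_L2 Q_posdef R_posdef n_gt0 mu_gt0
    erefl erefl erefl erefl erefl erefl erefl erefl sK (kapE K)).
  by rewrite mulr_gt0 ?spectral_norm_gt0.
have lipschitz K V W (sK : sublevel S alpha K) : `|cost3 S K V W| <=
    hessian_lipschitz_const S alpha * (frobenius_norm V ^+ 2 * frobenius_norm W).
  exact: (third_derivative_le x_init_L2 Q_posdef R_posdef n_gt0 m_gt0 mu_gt0
    erefl erefl erefl erefl erefl erefl erefl erefl erefl sK (kapE K)).
have critical V : cost1 S Kdd V = 0 by exact: cost1_local_min.
have hessian V : l * frobenius_norm V ^+ 2 <= cost2 S Kdd V V.
  by rewrite sqr_frobenius_norm; exact: lambda_min_hessian_le.
have ball_sub E : frobenius_norm E <= r0 -> sublevel S alpha (Kdd + E).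
  move=> Er0; have [E0|En0] := eqVneq E 0.
    rewrite E0 addr0; split => //; apply: le_trans Kdd_sub.2 _; exact: ltW.
  apply: (near_sublevel_sub Kdd_sub); apply: lt_le_trans le_omega.
  have E_gt0 : 0 < frobenius_norm E by rewrite lt_def frobenius_norm_eq0 En0 frobenius_norm_ge0.
  have r0_gt0 : 0 < r0 by exact: lt_le_trans Er0.
  rewrite lte_fin; apply: le_lt_trans Er0 _.
  rewrite ltr_pdivlMr ?subr_gt0// mulrC ltr_pM2r//; lra.
have l_le_L : l <= smoothness_const S alpha.
  pose V : 'M[R]_(m, d) := const_mx 1.
  have V0 : V != 0.
    apply/eqP => /matrixP/(_ (Ordinal m_gt0) (Ordinal d_gt0)).
    by rewrite !mxE => /eqP; rewrite oner_eq0.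
  have v2 : 0 < frobenius_norm V ^+ 2 by rewrite sqr_frobenius_norm dot_gt0.
  have sK : sublevel S alpha Kdd by rewrite -[Kdd]addr0; apply: ball_sub;
    rewrite frobenius_normE dot0l sqrtr0.
  by rewrite -(ler_pM2r v2); apply: le_trans (hessian V) (smooth _ _ sK).
have etaL : eta * smoothness_const S alpha <= 1.
  by move: eta_le; rewrite ler_pdivlMr.
have etal : eta * l <= 1 by apply: le_trans etaL; rewrite ler_pM2l.
move=> i; exact: (descent_linear_rate x_init_L2 Q_posdef R_posdef smooth lipschitz critical
  hessian l_gt0 M_gt0 (ltW eta_gt0) etaL etal r0_lt ball_sub).
Qed.
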